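(* Let $\sigma=(\sigma_1,\dots,\sigma_d)\in C^\infty(\mathbb R^n,\mathbb R^n\otimes(\mathbb R^d)^* )$, $z_1,z_2\in\mathbb R^n$, $m\ge0$, $\tau_0\in\mathcal T$, and let $\mathbb X:\mathcal F^{\le m}\to\mathbb R$ be a multiplicative functional. Then $$\Upsilon_{\tau_0}(z_2)-\sum_{w\in\mathcal F^{\le m}}\frac{\Upsilon_{w\curvearrowright\tau_0}(z_1)}{\pi(w)}\,\mathbb X(w)=\sum_{w\in\mathcal F^{\le m}}H_{z_1z_2}(w;\tau_0)\cdot z^{[m+1-|w|]}\,\mathbb X(w),$$ where $z^{[j+1]}:=z_2-z_1-\sum_{\tau\in\mathcal T^{\le j}}\Upsilon_\tau(z_1)\,\mathbb X(\tau)$ for $j\ge0$ and $H_{z_1z_2}(w;\tau_0)\in\mathbb R^n\otimes(\mathbb R^n)^*$ is the explicit expression defined in the context.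
   Context: Trees. $\mathcal T$: finite non-planar rooted trees with vertices decorated by $\{1,\dots,d\}$; $|\tau|$: number of vertices. $\mathcal F$: forests, i.e. finite commutative products (multisets) of trees, including the empty forest $\mathbf 1$; $|w|$: total number of vertices. $\mathcal T^{\le m},\mathcal F^{\le m}$: elements with at most $m$ vertices. $[w]_i$: tree obtained by joining the roots of the trees of $w$ to a new root decorated by $i$; $\bullet_i=[\mathbf 1]_i$. If $w=\tau_1^{n_1}\cdots\tau_k^{n_k}$ with distinct $\tau_i$, $\pi(w):=\prod_i n_i!$. Grafting. $\tau\curvearrowright\mathbf 1=0$, $\tau\curvearrowright[w]_i=[\tau w+\tau\curvearrowright w]_i$, $\tau\curvearrowright(\tau_1\cdots\tau_k)=\sum_i\tau_1\cdots(\tau\curvearrowright\tau_i)\cdots\tau_k$ (extended linearly), and $\mathbf 1\curvearrowright\tau=\tau$, $(\tau_1\cdots\tau_k)\curvearrowright\tau=\tau_1\curvearrowright((\tau_2\cdots\tau_k)\curvearrowright\tau)-(\tau_1\curvearrowright(\tau_2\cdots\tau_k))\curvearrowright\tau$. Elementary differentials. $\Upsilon_{\bullet_j}=\sigma_j:\mathbb R^n\to\mathbb R^n$, $\Upsilon_{[\tau_1\cdots\tau_k]_j}=\sum_{i_1,\dots,i_k}\partial_{i_1}\cdots\partial_{i_k}\sigma_j\,\Upsilon_{\tau_1}^{i_1}\cdots\Upsilon_{\tau_k}^{i_k}$, extended linearly to linear combinations of trees. $\nabla\Upsilon_\tau(z)$ is the $n\times n$ matrix with entries $\partial_b\Upsilon_\tau^a(z)$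 (row $a$, column $b$). Multiplicative functional: $\mathbb X(\mathbf 1)=1$ and $\mathbb X(w_1w_2)=\mathbb X(w_1)\mathbb X(w_2)$ whenever $w_1w_2\in\mathcal F^{\le m}$. Planar binary trees. $\mathcal T_b$: the set of planar binary trees with leaves decorated by $\mathbb N=\{0,1,\dots\}$: either a single leaf $\bullet_a$, or $[\rho',\rho'']$ (root with left subtree $\rho'$ and right subtree $\rho''$). For $I=(i_1,\dots,i_k)$ a string of positive integers, $\mathcal T_b^I$ is the set of $\rho\in\mathcal T_b$ with $k+1$ leaves whose decorations read from right to left are $0,i_1,\dots,i_k$. $m_L(\rho)$ and $m_R(\rho)$ are the distances from the root to the leftmost, resp. rightmost, leaf. Every $\rho$ is uniquely $\rho=[\dots[[\bullet_i,\rho_{m_L(\rho)}],\rho_{m_L(\rho)-1}],\dots,\rho_1]$. For $m_L(\rho)\ge1$, $V^-(\rho):=[\dots[\rho_{m_L(\rho)},\rho_{m_L(\rho)-1}],\dots,\rho_1]$. For $\ell\le m_L(\rho)$, $P_{\rho,\ell}:=[\dots[\bullet_i,\rho_{m_L(\rho)}],\dots,\rho_\ell]$, and $P_{\rho,m_L(\rho)+1}:=\bullet_i$. Set $\rho^{(\ell)}_i:=\rho_i$ for $i<\ell$ and $\rho^{(\ell)}_\ell:=P_{\rho,\ell}$, $1\le\ell\le m_L(\rho)+1$. Given trees $\tau_0,\dots,\tau_k\in\mathcal T$, $G(\bullet_i)=\tau_i$ and $G([\rho',\rho''])=G(\rho')\curvearrowright G(\rho'')$. Multi-indices $J$. $\{0,\dots,k\}^\ell_<$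 is the set of strictly increasing $\ell$-tuples in $\{0,\dots,k\}$. For $\rho\in\mathcal T_b$ with $k+1$ leaves and $1\le\ell\le m_L(\rho)+1$, $J_{\rho,\ell}:\{0,\dots,k\}^\ell_<\to\mathbb N$ is defined recursively: for a single leaf, $J_{\bullet_i,1}(0)=1$; otherwise, with $M:=m_L(\rho)$ and $J':=J_{V^-(\rho),M}$ (defined on $\{0,\dots,k-1\}^M_<$): $J_{\rho,1}(j)=\sum_{i_1<\dots<i_M<k}\mathbf 1_{\{i_1<j\}}J'(i_1,\dots,i_M)$; for $2\le\ell\le M$, $J_{\rho,\ell}(j_1,\dots,j_\ell)=\sum_{i_\ell<\dots<i_M<k}\mathbf 1_{\{j_\ell\le i_\ell\}}J'(j_1,\dots,j_{\ell-1},i_\ell,\dots,i_M)$; and $J_{\rho,M+1}(j_1,\dots,j_{M+1})=J'(j_1,\dots,j_M)$. Permutations. For an ordered family of trees $\boldsymbol\tau=(\tau_1,\dots,\tau_k)$ and $I_k=\{1,\dots,k\}$, $\mathcal P(I_k,\boldsymbol\tau)$ is the set of permutations $p$ of $I_k$ such that $p(i)\neq j$ if $\tau_i=\tau_j$ and $i\neq j$, for all $i,j\in I_k$. Definition of $H$. Let $u_j:=z_1+t_j(z_2-z_1)$, and for $\rho$ with $k+1$ leaves $$e(\mathcal A(\rho))(t_0,\dots,t_k):=\sum_{\ell=1}^{m_L(\rho)+1}(-1)^{\mathbf 1_{\{\ell>1\}}}\sum_{(j_1,\dots,j_\ell)\in\{0,\dots,k\}^\ell_<}J_{\rho,\ell}(j_1,\dots,j_\ell)\prod_{i=1}^\ell\nabla\Upsilon_{G(\rho_i^{(\ell)})}(u_{j_i}),$$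 matrix product ordered from left ($i=1$) to right. Then $H_{z_1z_2}(\mathbf 1;\tau_0):=\int_0^1\nabla\Upsilon_{\tau_0}(z_1+t(z_2-z_1))\,dt$ and, for $w=\tau_1\cdots\tau_k$, $k\ge1$, with $\boldsymbol\tau=(\tau_1,\dots,\tau_k)$, $$H_{z_1z_2}(w;\tau_0):=\sum_{p\in\mathcal P(I_k,\boldsymbol\tau)}\ \sum_{\rho\in\mathcal T_b^{(p(1),\dots,p(k))}}(-1)^{k-m_R(\rho)}\int_{1\ge t_0\ge\dots\ge t_k\ge0}e(\mathcal A(\rho))(t_0,\dots,t_k)\,dt_k\cdots dt_0.$$
   Formalization: In H, the set P(I_k,τ) is replaced by one permutation per distinct rearrangement of (τ_1,…,τ_k); the stated condition (p(i)≠j if τ_i=τ_j, i≠j) overcounts, e.g. for (a,a,b,b) it keeps 9 permutations rather than 6, and the identity then fails. *)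

(* Defs.v *)
From HB Require Import structures.
From mathcomp Require Import all_boot all_order all_algebra perm generic_quotient.
From mathcomp Require Import finmap multiset.
From mathcomp Require Import freeg.
From mathcomp Require Import all_classical all_reals all_analysis.

Set Implicit Arguments.
Unset Strict Implicit.
Unset Printing Implicit Defensive.

Import Order.TTheory GRing.Theory Num.Theory.
Import numFieldNormedType.Exports.

Local Open Scope classical_set_scope.
Local Open Scope mset_scope.
Local Open Scope quotient_scope.
Local Open Scope ring_scope.

Inductive ptree (d : nat) : Type := PNode of 'I_d & seq (ptree d).

HB.instance Definition _ (d : nat) := gen_eqMixin (ptree d).
HB.instance Definition _ (d : nat) := gen_choiceMixin (ptree d).

(* The congruence generated by permuting the children of a vertex; non-planar
   trees are planar trees modulo [piso]. *)
Inductive piso (d : nat) : ptree d -> ptree d -> Prop :=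
| piso_refl t : piso t t
| piso_sym t u : piso t u -> piso u t
| piso_trans t u v : piso t u -> piso u v -> piso t v
| piso_perm i s s' : perm_eq s s' -> piso (PNode i s) (PNode i s')
| piso_cong i s1 s2 t u :
    piso t u -> piso (PNode i (s1 ++ t :: s2)) (PNode i (s1 ++ u :: s2)).

Definition pisob (d : nat) : rel (ptree d) := fun t u => `[< piso t u >].

Lemma pisob_refl d : reflexive (@pisob d).
Proof. by move=> t; apply/asboolP; exact: piso_refl. Qed.

Lemma pisob_sym d : symmetric (@pisob d).
Proof.
by move=> t u; apply/idP/idP => /asboolP tu; apply/asboolP; exact: piso_sym.
Qed.

Lemma pisob_trans d : transitive (@pisob d).
Proof.
by move=> u t v /asboolP tu /asboolP uv; apply/asboolP; exact: piso_trans uv.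
Qed.

Canonical piso_equiv d :=
  EquivRel (@pisob d) (@pisob_refl d) (@pisob_sym d) (@pisob_trans d).
Canonical piso_encModRel d := defaultEncModRel (@pisob d).

Definition tree (d : nat) : Type := {eq_quot (@pisob d)}.
HB.instance Definition _ d := Quotient.on (tree d).
HB.instance Definition _ d := Choice.on (tree d).
HB.instance Definition _ d : EqQuotient _ (@pisob d) (tree d) :=
  EqQuotient.on (tree d).

Notation forest d := {mset tree d}.

Fixpoint psize (d : nat) (t : ptree d) : nat :=
  let: PNode _ s := t in (sumn [seq psize u | u <- s]).+1.

Definition tsize (d : nat) (t : tree d) : nat := psize (repr t).

Definition fsize (d : nat) (w : forest d) : nat :=
  (\sum_(t <- (w : seq (tree d))) tsize t)%N.

(* the symmetry factor pi(w) *)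
Definition symfact (d : nat) (w : forest d) : nat :=
  (\prod_(t <- finsupp w) (w t)`!)%N.

Definition lc (R : realType) (d : nat) := {freeg (tree d) / R}.

(* The planar trees whose classes, counted with multiplicity, sum to t ↷ u:
   t is attached to the root of u, or grafted on one of its branches. *)
Fixpoint pgraft (d : nat) (t u : ptree d) {struct u} : seq (ptree d) :=
  let: PNode i s := u in
  PNode i (t :: s) ::
  [seq PNode i w | w <-
    (fix pgraft_forest (s : seq (ptree d)) : seq (seq (ptree d)) :=
      if s is v :: s' then
        [seq v' :: s' | v' <- pgraft t v] ++
        [seq v :: w | w <- pgraft_forest s']
      else [::]) s].

Definition graft (R : realType) (d : nat) (t u : tree d) : lc R d :=
  \sum_(p <- pgraft (repr t) (repr u)) << \pi_(tree d) p >>.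

Definition graft_lc (R : realType) (d : nat) (x y : lc R d) : lc R d :=
  fglift (fun t => fglift (fun u => graft R t u) y) x.

(* w ↷ u for w the forest listed by s, by recursion on the number of trees:
   (t s') ↷ u = t ↷ (s' ↷ u) - (t ↷ s') ↷ u, where t ↷ s' is expanded by the
   Leibniz rule; N only has to be at least [size s]. *)
Fixpoint graft_rec (R : realType) (d N : nat) (s : seq (tree d)) (u : tree d)
    : lc R d :=
  match N, s with
  | N'.+1, t :: s' =>
      fglift (graft R t) (graft_rec R N' s' u) -
      \sum_(i < size s')
         fglift (fun v => graft_rec R N' (set_nth v s' i v) u)
                (graft R t (nth t s' i))
  | _, _ => << u >>
  end.

Definition graft_forest (R : realType) (d : nat) (w : forest d) (u : tree d)
    : lc R d :=
  graft_rec R (size (w : seq (tree d))) w u.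

Definition basis (R : realType) (n : nat) (i : 'I_n) : 'cV[R]_n := delta_mx i 0.

(* partials f [:: i_1; ...; i_k] is d_{i_1} ... d_{i_k} f *)
Definition partials (R : realType) (n : nat) (f : 'cV[R]_n -> 'cV[R]_n)
    (s : seq 'I_n) : 'cV[R]_n -> 'cV[R]_n :=
  foldr (fun i g z => 'D_(basis R i) g z) f s.

(* C^oo: all iterated partial derivatives exist and are Frechet-differentiable
   (hence continuous) everywhere. *)
Definition smooth (R : realType) (n : nat) (f : 'cV[R]_n -> 'cV[R]_n) : Prop :=
  forall (s : seq 'I_n) (z : 'cV[R]_n), differentiable (partials f s) z.

Fixpoint pelem (R : realType) (n d : nat) (sigma : 'I_d -> 'cV[R]_n -> 'cV[R]_n)
    (t : ptree d) (z : 'cV[R]_n) : 'cV[R]_n :=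
  let: PNode j s := t in
  let ys := [seq pelem sigma u z | u <- s] in
  \sum_(i : (size s).-tuple 'I_n)
     (\prod_(yi <- zip ys i) yi.1 yi.2 0) *: partials (sigma j) i z.

Definition elem (R : realType) (n d : nat) (sigma : 'I_d -> 'cV[R]_n -> 'cV[R]_n)
    (t : tree d) (z : 'cV[R]_n) : 'cV[R]_n :=
  pelem sigma (repr t) z.

Definition elem_lc (R : realType) (n d : nat)
    (sigma : 'I_d -> 'cV[R]_n -> 'cV[R]_n) (x : lc R d) (z : 'cV[R]_n)
    : 'cV[R]_n :=
  fglift (fun t => elem sigma t z) x.

Definition grad (R : realType) (n : nat) (f : 'cV[R]_n -> 'cV[R]_n)
    (z : 'cV[R]_n) : 'M[R]_n :=
  \matrix_(a, b) 'D_(basis R b) (fun y => f y a 0) z.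

(* Only the values of X on forests with at most m vertices are constrained. *)
Definition multiplicative (R : realType) (d m : nat) (X : forest d -> R) : Prop :=
  X mset0 = 1 /\
  forall w1 w2 : forest d,
    (fsize (w1 `+` w2) <= m)%N -> X (w1 `+` w2) = X w1 * X w2.

(* remainder j is z^{[j+1]} *)
Definition remainder (R : realType) (n d : nat)
    (sigma : 'I_d -> 'cV[R]_n -> 'cV[R]_n) (X : forest d -> R)
    (z1 z2 : 'cV[R]_n) (j : nat) : 'cV[R]_n :=
  z2 - z1 -
  \sum_(t \in [set t : tree d | (tsize t <= j)%N])
     X [mset t] *: elem sigma t z1.

Inductive btree : Type := BLeaf of nat | BNode of btree & btree.

HB.instance Definition _ := gen_eqMixin btree.
HB.instance Definition _ := gen_choiceMixin btree.

Fixpoint bleaves (r : btree) : seq nat :=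
  match r with
  | BLeaf a => [:: a]
  | BNode r1 r2 => bleaves r1 ++ bleaves r2
  end.

Definition Tb (I : seq nat) : set btree := [set r | rev (bleaves r) = 0%N :: I].

Fixpoint mR (r : btree) : nat := if r is BNode _ r2 then (mR r2).+1 else 0.

(* r = [..[[leaf i, r_M], r_{M-1}], .., r_1] has [spine r = [:: r_1; ..; r_M]],
   [left_leaf r = i] and m_L(r) = M. *)
Fixpoint spine (r : btree) : seq btree :=
  if r is BNode r1 r2 then r2 :: spine r1 else [::].

Fixpoint left_leaf (r : btree) : nat :=
  match r with BLeaf i => i | BNode r1 _ => left_leaf r1 end.

Definition mL (r : btree) : nat := size (spine r).

(* comb x [:: r_1; ..; r_M] is [..[x, r_M], .., r_1] *)
Definition comb (x : btree) (s : seq btree) : btree :=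
  foldr (fun r acc => BNode acc r) x s.

(* V^-(r), relevant only if 0 < mL r *)
Definition Vminus (r : btree) : btree :=
  comb (last r (spine r)) (take (mL r).-1 (spine r)).

Definition Psub (r : btree) (l : nat) : btree :=
  comb (BLeaf (left_leaf r)) (drop l.-1 (spine r)).

(* the list of rho^(l)_1, .., rho^(l)_l *)
Definition cut (r : btree) (l : nat) : seq btree :=
  rcons (take l.-1 (spine r)) (Psub r l).

(* J_rec k r [:: j_1; ..; j_l] is J_{r,l}(j_1, .., j_l) for r with k+1 leaves *)
Fixpoint J_rec (k : nat) (r : btree) (j : seq nat) {struct k} : nat :=
  if k is k'.+1 then
    let M := mL r in
    let J' := J_rec k' (Vminus r) in
    let l := size j in
    if l == 1%N then
      (\sum_(i : M.-tuple 'I_k'.+1 | sorted ltn (map val i))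
         (head 0 (map val i) < head 0 j) * J' (map val i))%N
    else if (l <= M)%N then
      (\sum_(i : (M - l).+1.-tuple 'I_k'.+1 | sorted ltn (map val i))
         (last 0 j <= head 0 (map val i)) *
         J' (take l.-1 j ++ map val i))%N
    else J' (take M j)
  else 1%N.

Definition J (r : btree) (j : seq nat) : nat := J_rec (size (bleaves r)).-1 r j.

Fixpoint Gtree (R : realType) (d : nat) (taus : nat -> tree d) (r : btree)
    : lc R d :=
  match r with
  | BLeaf a => << taus a >>
  | BNode r1 r2 => graft_lc (Gtree R taus r1) (Gtree R taus r2)
  end.

Definition eA (R : realType) (n d : nat)
    (sigma : 'I_d -> 'cV[R]_n -> 'cV[R]_n) (z1 z2 : 'cV[R]_n)
    (taus : nat -> tree d) (k : nat) (r : btree) (t : seq R) : 'M[R]_n :=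
  \sum_(1 <= l < (mL r).+2)
    (-1) ^+ (1 < l)%N *:
    \sum_(j : l.-tuple 'I_k.+1 | sorted ltn (map val j))
      (J r (map val j))%:R *:
      \prod_(i < l)
        grad (elem_lc sigma (Gtree R taus (nth (BLeaf 0) (cut r l) i)))
             (z1 + t`_(tnth j i) *: (z2 - z1)).

(* the iterated integral of f over b >= t_0 >= ... >= t_{N-1} >= 0 *)
Fixpoint simplex_int (R : realType) (N : nat) (b : R) (f : seq R -> R) : R :=
  if N is N'.+1 then
    \int[lebesgue_measure]_(t in `[0, b])
       simplex_int N' t (fun s => f (t :: s))
  else f [::].

(* One permutation p for each distinct rearrangement (ts_p(1), .., ts_p(k)) of
   ts: p lists the indices of equal trees in increasing order.  The literal
   condition "p i != j whenever i != j and ts_i = ts_j" does not select such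
   representatives: for ts = (a, a, b, b) it keeps all four permutations
   producing (b, b, a, a), H then depends on how ts is listed, and the expansion
   in terms of H fails for forests of four trees. *)
Definition perms (d : nat) (ts : seq (tree d)) : {set 'S_(size ts)} :=
  [set p : 'S_(size ts) |
   [forall i : 'I_(size ts), forall j : 'I_(size ts),
     ((i < j)%N && (tnth (in_tuple ts) (p i) == tnth (in_tuple ts) (p j)))
       ==> (p i < p j)%N]].

Definition H (R : realType) (n d : nat) (sigma : 'I_d -> 'cV[R]_n -> 'cV[R]_n)
    (z1 z2 : 'cV[R]_n) (ts : seq (tree d)) (tau0 : tree d) : 'M[R]_n :=
  let k := size ts in
  if k == 0%N then
    \matrix_(a, b) \int[lebesgue_measure]_(t in `[0, 1])
      grad (elem sigma tau0) (z1 + t *: (z2 - z1)) a b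
  else
    \sum_(p in perms ts)
      \sum_(r \in Tb [seq (p i).+1 | i : 'I_(size ts)])
        (-1) ^+ (k - mR r) *:
        \matrix_(a, b) simplex_int k.+1 1
          (fun t => eA sigma z1 z2 (nth tau0 (tau0 :: ts)) k r t a b).

(* Main.v *)
(* Write h = z2 - z1 and u_t = z1 + t h. By the fundamental theorem of calculus,
   H(1) h = Upsilon_tau0(z2) - Upsilon_tau0(z1). The trees r with leaves
   (0, i_1, .., i_k) are obtained from those with leaves (0, i_1, .., i_(k-1)) by
   inverting V^-, and the recursion for J is an integration by parts in the time
   variable that belongs to the new subtree. Summed over r, this says that the
   iterated integrals K(f_1, .., f_k) attached to a word of vector fields satisfy
     K(f_1, .., f_(k-1)) f_k(z1) = K(f_1, .., f_k) h + A(f_1, .., f_k)(z1) t^k / k!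
   with integrals up to time t, where A is a multilinear combination of iterated
   pre-Lie products that does not depend on h. Identifying A needs no further
   combinatorics: when all f_i are one field f, taking h = f(z1) and iterating the
   identity expands f_0(u_t) in powers of t, so A(f, .., f)(z1) is the Taylor
   coefficient D^k f_0 (f, .., f)(z1), and polarization gives the symmetrization
   of A. On the other side, Upsilon_(w ~> tau0) is D^k Upsilon_tau0 applied to the
   fields of the trees of w. Hence
     H(w) h = sum_(t in w) H(w - t) Upsilon_t(z1) - Upsilon_(w ~> tau0)(z1) / pi(w),
   the sum being over the distinct trees t of w. Multiplying by X(w), summing over
   w and reindexing the double sum by w = t w' gives the expansion. *)
Require Import Defs.
From HB Require Import structures.
From mathcomp Require Import all_boot all_order all_algebra perm generic_quotient.
From mathcomp Require Import finmap multiset.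
From mathcomp Require Import freeg.
From mathcomp Require Import all_classical all_reals all_analysis.
From mathcomp Require Import ring lra zify.

Set Implicit Arguments.
Unset Strict Implicit.
Unset Printing Implicit Defensive.

Import Order.TTheory GRing.Theory Num.Theory.
Import numFieldNormedType.Exports.
Import Defs.

Local Open Scope classical_set_scope.
Local Open Scope ring_scope.

(** The trees record how one vector travels through a chain of gradients. The factor f_k(z1) is the
    field f_k along the line, taken at time 0. A vector W moves from a time t_i' up to a larger time
    t_i by W(t_i') = W(t_i) - int W'(s) ds over t_i' <= s <= t_i; the rank of s among the other
    times is a new summation index, and J counts these insertions. At t_i the vector meets the
    gradient of some field f, becomes the pre-Lie product W ~> f and moves on. Past the first
    gradient it goes down to time 0 instead: hence the value at z1, and the opposite sign of the
    terms with l = 1. For one fixed h the identity says nothing about A, since K(f_1, .., f_k) h is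
    unknown. As A does not depend on h, a new h may be chosen for each field, and powers of t are
    then compared using only bounds of the form C t^N on iterated integrals. The factor 1/pi(w) has
    two sources: w has k!/pi(w) distinct orderings, and the simplex of times has volume 1/k!.
    Integrals are treated as primitives vanishing at 0 of continuous functions, so that identities
    between them are checked by differentiation. *)

(** * Primitives of continuous functions on the whole real line *)

Section Primitive.
Variable R : realType.
Implicit Types g h : R -> R.

(** The lower end lies below both 0 and [y], so one formula serves for both signs of [y] and the
    derivative exists on both sides of 0. *)
Definition primitive g (y : R) : R :=
  \int[lebesgue_measure]_(t in `[- (`|y| + 1), y]) g t -
  \int[lebesgue_measure]_(t in `[- (`|y| + 1), 0]) g t.

Lemma continuous_integrable_itv g (a b : R) : continuous g ->
  lebesgue_measure.-integrable `[a, b] (EFin \o g).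
Proof.
move=> cg; apply: continuous_compact_integrable; first exact: segment_compact.
exact: continuous_subspaceT.
Qed.

Lemma integral_sub_base g (a c y : R) : continuous g -> a <= c -> c <= y -> c <= 0 ->
  \int[lebesgue_measure]_(t in `[a, y]) g t -
  \int[lebesgue_measure]_(t in `[a, 0]) g t =
  \int[lebesgue_measure]_(t in `[c, y]) g t -
  \int[lebesgue_measure]_(t in `[c, 0]) g t.
Proof.
move=> cg ac cy c0.
have split_at z : c <= z -> \int[lebesgue_measure]_(t in `[a, z]) g t -
  \int[lebesgue_measure]_(t in `[a, c]) g t = \int[lebesgue_measure]_(t in `[c, z]) g t.
  move=> cz; rewrite Rintegral_itvB ?bnd_simp//; last exact: continuous_integrable_itv.
  rewrite Rintegral_itv_obnd_cbnd//.
  by apply: integrableS (continuous_integrable_itv c z cg) => //; exact: subset_itv_oc_cc.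
by rewrite -(split_at y)// -(split_at 0)//; ring.
Qed.

Lemma primitive0 g : primitive g 0 = 0.
Proof. by rewrite /primitive subrr. Qed.

Lemma integral_primitive g (b : R) : continuous g -> 0 <= b ->
  \int[lebesgue_measure]_(t in `[0, b]) g t = primitive g b.
Proof.
move=> cg b0; rewrite /primitive (@integral_sub_base _ _ 0)//.
by rewrite set_itv1 Rintegral_set1 subr0.
Qed.

Lemma is_derive_primitive g (x : R) : continuous g -> is_derive x 1 (primitive g) (g x).
Proof.
move=> cg.
(* A fixed base, below the moving base of [primitive g y] for every [y] at distance less than 1 from
   [x]. *)
pose a := - (`|x| + 2%:R).
pose F := fun y : R => \int[lebesgue_measure]_(t in `[a, y]) g t.
have ax : a < x.
  rewrite /a; have := ler_norm (- x); rewrite normrN; lra.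
have [dF F'] : derivable F x 1 /\ (F^`())%classic x = g x.
  apply: (@continuous_FTC1 _ _ (BLeft a) x (x + 1)) => //; last exact: cg.
    by rewrite ltrDl.
  exact: continuous_integrable_itv.
have isF : is_derive x 1 (F - cst (F 0)) (g x).
  rewrite -[g x]subr0 -F' derive1E; apply: is_deriveB.
  exact/derivableP.
apply: near_eq_is_derive isF.
near=> y.
have yx : `|x - y| < 1 by near: y; apply: nbhsx_ballx.
rewrite /primitive /F /= /cst !fctE.
apply: integral_sub_base => //; rewrite /a.
- have := ler_normD (y - x) x; rewrite subrK distrC; lra.
- have := ler_norm (- y); rewrite normrN; lra.
Unshelve. all: by end_near. Qed.

Lemma derivative_unique g h : (forall x : R, is_derive x 1 g (h x)) -> g 0 = 0 ->
  continuous h -> g = primitive h.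
Proof.
move=> dg g0 ch; apply/funext => x; apply/eqP; rewrite -subr_eq0; apply/eqP.
have -> : g x - primitive h x = (g - primitive h) 0.
  rewrite -[LHS]/((g - primitive h) x).
  apply: is_derive_0_is_cst => y.
  rewrite -[0](subrr (h y)); apply: is_deriveB.
  exact: is_derive_primitive.
by rewrite !fctE g0 primitive0 subrr.
Qed.

Lemma is_derive_continuous g h : (forall x : R, is_derive x 1 g (h x)) -> continuous g.
Proof.
move=> dg x; apply: differentiable_continuous; apply/derivable1_diffP.
by case: (dg x).
Qed.

Lemma primitive_continuous g : continuous g -> continuous (primitive g).
Proof. by move=> cg; apply: is_derive_continuous => x; exact: is_derive_primitive. Qed.

End Primitive.

(** * Matrix-valued curves, iterated integrals and integration by parts *)

Section Curves.
Variable R : realType.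

Lemma continuous_bigsum (I : Type) (s : seq I) (P : pred I) (F : I -> R -> R) :
  (forall i, continuous (F i)) -> continuous (fun t => \sum_(i <- s | P i) F i t).
Proof.
move=> cF; rewrite (_ : (fun t => _) = \sum_(i <- s | P i) F i); last first.
  by apply/funext => t; rewrite fct_sumE.
by elim/big_ind: _ => [|f g cf cg|i _]; [exact: cst_continuous| |exact: cF] => x;
  apply: continuousD; [exact: cf | exact: cg].
Qed.

Lemma is_derive_bigsum (I : Type) (s : seq I) (P : pred I) (F : I -> R -> R)
    (F' : I -> R) (x : R) :
  (forall i, is_derive x 1 (F i) (F' i)) ->
  is_derive x 1 (fun t => \sum_(i <- s | P i) F i t) (\sum_(i <- s | P i) F' i).
Proof.
move=> dF; rewrite (_ : (fun t => _) = \sum_(i <- s | P i) F i); last first.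
  by apply/funext => t; rewrite fct_sumE.
elim/big_ind2: _ => [|f f' g g' cf cg|i _]; [|exact: is_deriveD|exact: dF].
exact: is_derive_cst.
Qed.

Lemma is_derive_ext (f g : R -> R) (x df dg : R) :
  is_derive x 1 f df -> f =1 g -> df = dg -> is_derive x 1 g dg.
Proof. by move=> + /funext fg dfg; rewrite fg dfg. Qed.

Record curve p q := Curve {
  cval :> R -> 'M[R]_(p, q);
  ccont : forall a b, continuous (fun t => cval t a b) }.

Definition mderive p q (W B : R -> 'M[R]_(p, q)) :=
  forall a b (x : R), is_derive x 1 (fun t => W t a b) (B x a b).

Lemma cst_cont p q (A : 'M[R]_(p, q)) a b : continuous (fun _ : R => A a b).
Proof. exact: cst_continuous. Qed.

Definition ccst p q (A : 'M[R]_(p, q)) := Curve (@cst_cont _ _ A).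

Lemma mul_cont p q r (B : curve p q) (C : curve q r) a b :
  continuous (fun t => (B t *m C t) a b).
Proof.
rewrite (_ : (fun t => _) = (fun t => \sum_j B t a j * C t j b)); last first.
  by apply/funext => t; rewrite mxE.
by apply: continuous_bigsum => j x; apply: continuousM; apply: ccont.
Qed.

Definition cmul p q r (B : curve p q) (C : curve q r) := Curve (@mul_cont _ _ _ B C).

Lemma mprim_cont p q (B : curve p q) a b :
  continuous (fun t => (\matrix_(a, b) primitive (fun t => B t a b) t) a b).
Proof.
rewrite (_ : (fun t => _) = primitive (fun t => B t a b)); last first.
  by apply/funext => t; rewrite mxE.
by apply: primitive_continuous; exact: ccont.
Qed.

(** Locked, so that unification does not unfold iterated integrals into Lebesgue integrals; [mprimE]
    is the way in. *)
Definition mprim p q (B : curve p q) : curve p q := locked (Curve (@mprim_cont _ _ B)).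

Lemma mprimE p q (B : curve p q) t a b :
  mprim B t a b = primitive (fun t => B t a b) t.
Proof. by rewrite /mprim -lock mxE. Qed.

Lemma mprimP p q (B : curve p q) : mderive (mprim B) B.
Proof.
move=> a b x; rewrite (_ : (fun t => _) = primitive (fun t => B t a b)); last first.
  by apply/funext => t; rewrite mprimE.
by apply: is_derive_primitive; exact: ccont.
Qed.

Lemma mprim0 p q (B : curve p q) : mprim B 0 = 0.
Proof. by apply/matrixP => a b; rewrite mprimE primitive0 mxE. Qed.

Lemma mprim_unique p q (W : R -> 'M[R]_(p, q)) (B : curve p q) t :
  mderive W B -> W 0 = 0 -> W t = mprim B t.
Proof.
move=> dW W0; apply/matrixP => a b; rewrite mprimE.
have := @derivative_unique _ (fun t => W t a b) _ (dW a b).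
by rewrite W0 mxE => <-//; exact: ccont.
Qed.

Lemma mprim_ext p q (B C : curve p q) t : B =1 C -> mprim B t = mprim C t.
Proof.
move=> BC; apply: mprim_unique; rewrite ?mprim0// => a b x.
by rewrite -BC; exact: mprimP.
Qed.

Lemma mprim_comb p q (B C D : curve p q) c t :
  (forall t, B t = C t + c *: D t) -> mprim B t = mprim C t + c *: mprim D t.
Proof.
move=> BCD; apply/esym.
apply: (@mprim_unique _ _ (fun t => mprim C t + c *: mprim D t)).
  move=> a b x; apply: (is_derive_ext (is_deriveD (mprimP C a b x)
    (is_deriveZ c (mprimP D a b x)))); last by rewrite BCD !mxE.
  by move=> y; rewrite [RHS]mxE [X in _ = _ + X]mxE.
by rewrite !mprim0 scaler0 addr0.
Qed.

Lemma mprim_mulr p q r (B : curve p q) (C : curve p r) (A : 'M[R]_(q, r)) t :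
  (forall t, C t = B t *m A) -> mprim C t = mprim B t *m A.
Proof.
move=> CB; apply/esym; apply: (@mprim_unique _ _ (fun t => mprim B t *m A)).
  move=> a b x; rewrite CB mxE.
  have dB j := is_derive_ext (is_deriveZ (A j b) (mprimP B a j x))
    (fun=> erefl) (mulrC _ _).
  apply: (is_derive_ext (is_derive_bigsum _ _ dB)) => // y.
  by rewrite mxE; apply: eq_bigr => j _; rewrite mulrC.
by rewrite mprim0 mul0mx.
Qed.

(** The volume of the simplex t >= s_1 >= .. >= s_m >= 0. *)
Definition vol (m : nat) (t : R) : R := t ^+ m / m`!%:R.

Lemma vol0 t : vol 0 t = 1. Proof. by rewrite /vol expr0 fact0 divr1. Qed.

Lemma volS0 m : vol m.+1 0 = 0. Proof. by rewrite /vol expr0n mul0r. Qed.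

Lemma is_derive_vol m (x : R) : is_derive x 1 (vol m.+1) (vol m x).
Proof.
rewrite (_ : vol m.+1 = (m.+1`!%:R^-1) \*: (id ^+ m.+1)); last first.
  by apply/funext => t; rewrite /vol /= exprfctE mulrC.
apply: is_derive_eq; rewrite /vol /GRing.scale /= mulr1 factS natrM invfM.
rewrite mulrCA !mulrA divff ?pnatr_eq0// mul1r mulrC; congr (_ * _).
Qed.

Lemma vol_continuous m : continuous (vol m).
Proof.
case: m => [|m]; last exact: (is_derive_continuous (is_derive_vol m)).
by rewrite (_ : vol 0 = cst 1); [exact: cst_continuous|apply/funext => t; rewrite vol0].
Qed.

Lemma volc_cont m p q (W : curve p q) a b : continuous (fun t => (vol m t *: W t) a b).
Proof.
rewrite (_ : (fun t => _) = (fun t => vol m t * W t a b)); last first.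
  by apply/funext => t; rewrite mxE.
by move=> x; apply: continuousM; [exact: vol_continuous|exact: ccont].
Qed.

Definition volc m p q (W : curve p q) := Curve (@volc_cont m _ _ W).

(* [insertc m W] is the integral of [W s_1] over [t >= s_1 >= .. >= s_m >= 0],
   where [s_1] is to be read as [0] when [m = 0]. *)
Definition insertc m p q (W : curve p q) : curve p q :=
  if m is m'.+1 then mprim (volc m' W) else ccst (W 0).

(** Integration by parts against [vol m], whose derivative is the weight inside [insertc m]. For
    [m = 0] the subtracted term is the boundary value [W 0], which is why [insertc 0] is evaluation
    at time 0. *)
Lemma insertc_parts m p q (W W' : curve p q) t : mderive W W' ->
  insertc m.+1 W' t = volc m W t - insertc m W t.
Proof.
move=> dW; apply/esym; set F := fun t => volc m W t - insertc m W t.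
apply: (@mprim_unique _ _ F (volc m W')); last first.
  rewrite /F /=; case: m {F} => [|m] /=; first by rewrite vol0 scale1r subrr.
  by rewrite volS0 scale0r mprim0 subrr.
move=> a b x; rewrite /F {F}; case: m => [|m] /=.
  apply: (is_derive_ext (is_deriveB (dW a b x) (is_derive_cst (W 0 a b) x 1))).
    by move=> y; rewrite [RHS]mxE [X in _ = X + _]mxE [X in _ = _ + X]mxE vol0 mul1r.
  by rewrite subr0 vol0 scale1r.
have dM := is_deriveM (is_derive_vol m x) (dW a b x).
apply: (is_derive_ext (is_deriveB dM (mprimP (volc m W) a b x))).
  by move=> y; rewrite [RHS]mxE [X in _ = X + _]mxE [X in _ = _ + X]mxE.
by rewrite /= !mxE /GRing.scale /= [W x a b * _]mulrC addrK.
Qed.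

(** The product of the matrices of [Bs] at successive decreasing times below t, times [W] at the
    last of these times (at t itself if [Bs] is empty), integrated over the simplex. *)
Definition iter_int n q (Bs : seq (curve n n)) (W : curve n q) : curve n q :=
  foldr (fun B acc => mprim (cmul B acc)) W Bs.

Lemma iter_int_ext n q (Bs : seq (curve n n)) (W W' : curve n q) t :
  W =1 W' -> iter_int Bs W t = iter_int Bs W' t.
Proof.
elim: Bs t => [|B Bs IH] t WW /=; first exact: WW.
by apply: mprim_ext => s /=; rewrite IH.
Qed.

Lemma iter_int_comb n q (Bs : seq (curve n n)) (W W1 W2 : curve n q) c t :
  (forall t, W t = W1 t + c *: W2 t) ->
  iter_int Bs W t = iter_int Bs W1 t + c *: iter_int Bs W2 t.
Proof.
elim: Bs t => [|B Bs IH] t WW /=; first exact: WW.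
by apply: mprim_comb => s /=; rewrite IH// mulmxDr scalemxAr.
Qed.

Lemma iter_int_mulr n p q (Bs : seq (curve n n)) (W : curve n p) (W' : curve n q) A t :
  (forall t, W' t = W t *m A) -> iter_int Bs W' t = iter_int Bs W t *m A.
Proof.
elim: Bs t => [|B Bs IH] t WW /=; first exact: WW.
by apply: mprim_mulr => s /=; rewrite IH// mulmxA.
Qed.

Lemma iter_int_cat n q (Bs Cs : seq (curve n n)) (W : curve n q) :
  iter_int (Bs ++ Cs) W = iter_int Bs (iter_int Cs W).
Proof. exact: foldr_cat. Qed.

Definition cone n : curve n n := ccst 1%:M.

Lemma iter_int_one n q m (A : 'M[R]_(n, q)) t :
  iter_int (nseq m (cone n)) (ccst A) t = vol m t *: A.
Proof.
elim: m t => [|m IH] t /=; first by rewrite vol0 scale1r.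
apply/esym; apply: (@mprim_unique _ _ (fun t => vol m.+1 t *: A)).
  move=> a b x; apply: (is_derive_ext (is_deriveZ (A a b) (is_derive_vol m x))).
    by move=> y; rewrite mxE mulrC.
  by rewrite /= mul1mx IH mxE mulrC.
by rewrite volS0 scale0r.
Qed.

End Curves.
Arguments cone {R n}.

(** * Derivatives along lines and the symmetry of mixed second derivatives *)

Section Lines.
Variables (R : realType) (V : normedModType R).

Lemma is_derive_line (phi : V -> R) (w v : V) (x : R) :
  derivable phi (w + x *: v) v ->
  is_derive x 1 (fun x => phi (w + x *: v)) ('D_v phi (w + x *: v)).
Proof.
move=> dphi.
have E : (fun h : R => h^-1 *: (((fun x => phi (w + x *: v)) \o shift x) (h *: (1 : R)) -
    phi (w + x *: v))) =
  (fun h : R => h^-1 *: ((phi \o shift (w + x *: v)) (h *: v) - phi (w + x *: v))).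
  apply/funext => h /=; congr (_ *: (phi _ - _)).
  by rewrite [h *: 1]mulr1 scalerDl addrCA.
by split; rewrite /derivable /derive E.
Qed.

(** The mean value theorem in the direction [b], then in the direction [c] for the derivative so
    obtained. *)
Lemma second_difference (phi : V -> R) (b c z : V) (s t : R) :
  (forall w, derivable phi w b) -> (forall w, derivable ('D_b phi) w c) ->
  0 <= s -> 0 <= t ->
  exists xi eta, [/\ 0 <= xi <= s, 0 <= eta <= t &
    phi (z + t *: c + s *: b) - phi (z + s *: b) - (phi (z + t *: c) - phi z) =
    'D_c ('D_b phi) (z + xi *: b + eta *: c) * t * s].
Proof.
move=> db dc s0 t0.
pose A := (fun x => phi (z + t *: c + x *: b)) - (fun x => phi (z + x *: b)).
have dA (x : R) : is_derive x 1 A ('D_b phi (z + t *: c + x *: b) - 'D_b phi (z + x *: b)).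
  by apply: is_deriveB; apply: is_derive_line.
have [|xi xi_in EA] := MVT_segment s0 (fun x _ => dA x).
  apply: continuous_subspaceT; exact: is_derive_continuous dA.
pose B := fun y => 'D_b phi (z + xi *: b + y *: c).
have dB (y : R) : is_derive y 1 B ('D_c ('D_b phi) (z + xi *: b + y *: c)).
  exact: is_derive_line.
have [|eta eta_in EB] := MVT_segment t0 (fun x _ => dB x).
  apply: continuous_subspaceT; exact: is_derive_continuous dB.
exists xi, eta; split; [by move: xi_in; rewrite in_itv|by move: eta_in; rewrite in_itv|].
transitivity (A s - A 0); first by rewrite /A !fctE !scale0r !addr0.
rewrite EA subr0; congr (_ * _).
by move: EB; rewrite /B scale0r addr0 subr0 => <-; rewrite addrAC.
Qed.

(** The second difference over a parallelogram is symmetric in its two sides, so the two mixed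
    derivatives share a value at points arbitrarily close to [z]. *)
Lemma schwarz (phi : V -> R) (b c z : V) :
  (forall w, derivable phi w b) -> (forall w, derivable phi w c) ->
  (forall w, derivable ('D_b phi) w c) -> (forall w, derivable ('D_c phi) w b) ->
  {for z, continuous ('D_c ('D_b phi))} -> {for z, continuous ('D_b ('D_c phi))} ->
  'D_c ('D_b phi) z = 'D_b ('D_c phi) z.
Proof.
move=> db dc dbc dcb /cvgrPdist_lt c1 /cvgrPdist_lt c2.
apply/eqP; rewrite -subr_eq0 -normr_le0; apply/ler_addgt0Pl => e e0; rewrite addr0.
have e2 : 0 < e / 2 by rewrite divr_gt0.
have /nbhs_ballP[d1 /= d10 h1] := c1 _ e2.
have /nbhs_ballP[d2 /= d20 h2] := c2 _ e2.
pose K := `|b| + `|c| + 1.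
have K0 : 0 < K by rewrite /K ltr_wpDl// addr_ge0.
(* The parallelogram with sides [s *: b] and [s *: c] stays within [s * K] of [z], hence in both
   neighbourhoods. *)
pose s := Num.min d1 d2 / (2 * K).
have d0 : 0 < Num.min d1 d2 by rewrite lt_min d10 d20.
have s0 : 0 < s by rewrite divr_gt0// mulr_gt0.
have sd : s * K < Num.min d1 d2.
  by rewrite /s invfM mulrA mulfVK ?gt_eqF//; lra.
have near_z xi eta : 0 <= xi <= s -> 0 <= eta <= s ->
    `|z - (z + xi *: b + eta *: c)| < Num.min d1 d2.
  move=> /andP[xi0 xis] /andP[eta0 etas]; apply: le_lt_trans sd.
  rewrite -addrA opprD addrA subrr add0r normrN (le_trans (ler_normD _ _))//.
  rewrite !normrZ !ger0_norm// /K !mulrDr mulr1.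
  have xib : xi * `|b| <= s * `|b| by apply: ler_wpM2r.
  have etac : eta * `|c| <= s * `|c| by apply: ler_wpM2r.
  by move: s0 xib etac; lra.
have [x1 [y1 [x1s y1s E1]]] := second_difference z db dbc (ltW s0) (ltW s0).
have [y2 [x2 [y2s x2s E2]]] := second_difference z dc dcb (ltW s0) (ltW s0).
have E : 'D_c ('D_b phi) (z + x1 *: b + y1 *: c) = 'D_b ('D_c phi) (z + y2 *: c + x2 *: b).
  have sN0 : s != 0 by rewrite gt_eqF.
  apply: (mulIf sN0); apply: (mulIf sN0).
  rewrite -E1 -E2 [z + s *: b + s *: c]addrAC; ring.
have k1 := near_z _ _ x1s y1s; have k2 := near_z _ _ x2s y2s.
rewrite lt_min in k1; rewrite lt_min (addrAC z (x2 *: b)) in k2.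
have {}k1 : `|'D_c ('D_b phi) z - 'D_c ('D_b phi) (z + x1 *: b + y1 *: c)| < e / 2.
  by apply: h1; rewrite -ball_normE; case/andP: k1.
have {}k2 : `|'D_b ('D_c phi) z - 'D_b ('D_c phi) (z + y2 *: c + x2 *: b)| < e / 2.
  by apply: h2; rewrite -ball_normE; case/andP: k2.
rewrite -E distrC in k2; apply: ltW; apply: le_lt_trans (ler_distD _ _ _) _.
by rewrite [ltRHS]splitr; exact: ltrD k1 k2.
Qed.

End Lines.

(** * Stability properties of smooth maps *)

Section SmoothFields.
Variables (R : realType) (n : nat).
Local Notation V := 'cV[R]_n.
Local Notation "''d_' b f" := (fun z => 'D_(basis R b) f z) (at level 0, b at level 0, f at level 0).

Lemma smooth_diff (f : V -> V) z : smooth f -> differentiable f z.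
Proof. by move=> /(_ [::] z). Qed.

Lemma smooth_partial (f : V -> V) b : smooth f -> smooth ('d_b f).
Proof.
move=> sf s z; have := sf (rcons s b) z.
by rewrite /partials foldr_rcons.
Qed.

(** Smoothness is the largest class of differentiable maps stable under partial derivatives; an
    invariant class thus replaces closed formulas for iterated partials. *)
Lemma smooth_coind (P : (V -> V) -> Prop) :
  (forall f z, P f -> differentiable f z) -> (forall f b, P f -> P ('d_b f)) ->
  forall f, P f -> smooth f.
Proof.
move=> dP pP f Pf s z; apply: dP; elim: s => //= b s IH; exact: pP.
Qed.

Lemma colvec_basis (v : V) : v = \sum_b v b 0 *: basis R b.
Proof.
by rewrite [LHS]matrix_sum_delta; apply: eq_bigr => i _; rewrite big_ord1.
Qed.

Lemma derive_basis (W : normedModType R) (f : V -> W) (z v : V) : differentiable f z ->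
  'D_v f z = \sum_b v b 0 *: 'D_(basis R b) f z.
Proof.
move=> df; rewrite deriveE// {1}(colvec_basis v) linear_sum.
by apply: eq_bigr => b _; rewrite linearZ deriveE.
Qed.

Lemma diff_comp_entry (f : V -> V) a z : differentiable f z ->
  differentiable (fun y => f y a 0) z.
Proof.
move=> df; rewrite (_ : (fun y => _) = (fun N : V => N a 0 : R) \o f)//.
by apply: differentiable_comp => //; exact: differentiable_coord.
Qed.

Lemma derive_entry (f : V -> V) a (z v : V) : differentiable f z ->
  'D_v (fun y => f y a 0) z = ('D_v f z) a 0.
Proof. by move=> df; rewrite derive_mx ?mxE//; exact: diff_derivable. Qed.

Lemma diff_entries (f : V -> V) z : (forall a, differentiable (fun y => f y a 0) z) ->
  differentiable f z.
Proof.
move=> df; rewrite (_ : f = \sum_a (fun y => f y a 0 *: basis R a)).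
  by apply: differentiable_sum => a; apply: differentiableZl.
by apply/funext => y; rewrite fct_sumE -colvec_basis.
Qed.

Lemma derive_comp_mul (f g : V -> V) b c z : differentiable f z -> differentiable g z ->
  'D_(basis R c) (fun y => f y b 0 *: g y) z =
  'D_(basis R c) f z b 0 *: g z + f z b 0 *: 'D_(basis R c) g z.
Proof.
move=> df dg.
have dfg : differentiable (fun y => f y b 0 *: g y) z.
  apply: diff_entries => a; rewrite (_ : (fun y => _) = (fun y => f y b 0) * (fun y => g y a 0)).
    by apply: differentiableM; exact: diff_comp_entry.
  by apply/funext => y; rewrite mxE.
apply/matrixP => a i; rewrite (ord1 i) -derive_entry// {i}.
rewrite (_ : (fun y => _) = (fun y => f y b 0) * (fun y => g y a 0)); last first.
  by apply/funext => y; rewrite mxE.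
rewrite deriveM; [|exact/diff_derivable/diff_comp_entry..].
by rewrite !derive_entry// !mxE /GRing.scale /= addrC [g z a 0 * _]mulrC.
Qed.

(** The product rule turns a product into a sum of products, so products alone are not stable under
    differentiation; this closure is, and [smooth_coind] applies to it. *)
Inductive smooth_expr : (V -> V) -> Prop :=
| Sbase f : smooth f -> smooth_expr f
| Sadd f g : smooth_expr f -> smooth_expr g -> smooth_expr (f + g)
| Smul f g b : smooth_expr f -> smooth_expr g -> smooth_expr (fun z => f z b 0 *: g z).

Lemma smooth_expr_diff f z : smooth_expr f -> differentiable f z.
Proof.
move=> Sf; elim: Sf z => {f} [f sf|f g _ IHf _ IHg|f g b _ IHf _ IHg] z.
- exact: smooth_diff.
- exact: differentiableD.
- apply: diff_entries => a; rewrite (_ : (fun y => _) = (fun y => f y b 0) * (fun y => g y a 0)).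
    by apply: differentiableM; exact: diff_comp_entry.
  by apply/funext => y; rewrite mxE.
Qed.

Lemma smooth_exprP f : smooth_expr f -> smooth f.
Proof.
apply: smooth_coind => {f} [f z|f c]; first exact: smooth_expr_diff.
elim=> {f} [f sf|f g Sf IHf Sg IHg|f g b Sf IHf Sg IHg].
- exact/Sbase/smooth_partial.
- rewrite (_ : (fun z => _) = (fun z => 'D_(basis R c) f z) + (fun z => 'D_(basis R c) g z)).
    exact: Sadd.
  by apply/funext => z; rewrite deriveD//; exact/diff_derivable/smooth_expr_diff.
- rewrite (_ : (fun z => _) = (fun z => 'D_(basis R c) f z b 0 *: g z) +
    (fun z => f z b 0 *: 'D_(basis R c) g z)).
    by apply: Sadd; [exact: (Smul b IHf Sg)|exact: (Smul b Sf IHg)].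
  by apply/funext => z; rewrite derive_comp_mul//; exact: smooth_expr_diff.
Qed.

Lemma smooth_cst (v : V) : smooth (cst v).
Proof.
apply: (@smooth_coind (fun f => exists w, f = cst w)); last by exists v.
  by move=> _ z [w ->]; exact: differentiable_cst.
by move=> _ b [w ->]; exists 0; apply/funext => z; rewrite derive_cst.
Qed.

Lemma smoothD (f g : V -> V) : smooth f -> smooth g -> smooth (fun z => f z + g z).
Proof. by move=> sf sg; apply: smooth_exprP; apply: Sadd; exact: Sbase. Qed.

Lemma smooth_mul (f g : V -> V) b : smooth f -> smooth g -> smooth (fun z => f z b 0 *: g z).
Proof. by move=> sf sg; apply: smooth_exprP; apply: Smul; exact: Sbase. Qed.

Lemma smooth_sum (I : Type) (s : seq I) (F : I -> V -> V) :
  (forall i, smooth (F i)) -> smooth (fun z => \sum_(i <- s) F i z).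
Proof.
move=> sF; elim: s => [|i s IH].
  rewrite (_ : (fun z => _) = cst 0); first exact: smooth_cst.
  by apply/funext => z; rewrite big_nil.
rewrite (_ : (fun z => _) = (fun z => F i z + \sum_(i <- s) F i z)); first exact: smoothD.
by apply/funext => z; rewrite big_cons.
Qed.

Lemma smoothZ (f : V -> V) (c : R) : smooth f -> smooth (fun z => c *: f z).
Proof.
move=> sf.
apply: (@smooth_coind (fun g => exists2 f, smooth f & g = fun z => c *: f z)); last by exists f.
  by move=> _ z [g sg ->]; apply: differentiableZ; exact: smooth_diff.
move=> _ b [g sg ->]; exists ('d_b g); first exact: smooth_partial.
by apply/funext => z; rewrite deriveZ//; exact/diff_derivable/smooth_diff.
Qed.

Lemma partialC (f : V -> V) b c z : smooth f ->
  'D_(basis R b) ('d_c f) z = 'D_(basis R c) ('d_b f) z.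
Proof.
move=> sf; apply/matrixP => a i; rewrite (ord1 i) {i}.
pose phi y := f y a 0.
have Ed e : 'D_(basis R e) phi = fun y => 'd_e f y a 0.
  by apply/funext => y; rewrite derive_entry//; exact: smooth_diff.
have Edd e e' y : 'D_(basis R e) ('d_e' f) y a 0 =
    'D_(basis R e) ('D_(basis R e') phi) y.
  by rewrite Ed derive_entry//; exact/smooth_diff/smooth_partial.
have c0 e e' : continuous ('D_(basis R e) ('D_(basis R e') phi)).
  rewrite (_ : 'D_(basis R e) _ = fun y => 'D_(basis R e) ('d_e' f) y a 0).
    move=> y; apply/differentiable_continuous/diff_comp_entry/smooth_diff.
    exact/smooth_partial/smooth_partial.
  by apply/funext => y; exact/esym/Edd.
have d0 e y : derivable phi y (basis R e).
  by apply/diff_derivable/diff_comp_entry/smooth_diff.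
have d1 e e' y : derivable ('D_(basis R e') phi) y (basis R e).
  by rewrite Ed; apply/diff_derivable/diff_comp_entry/smooth_diff/smooth_partial.
transitivity ('D_(basis R b) ('D_(basis R c) phi) z); first exact: Edd.
transitivity ('D_(basis R c) ('D_(basis R b) phi) z); last exact/esym/Edd.
apply: schwarz; [exact: d0|exact: d0|exact: d1|exact: d1|exact: c0|exact: c0].
Qed.

Lemma gradE (f : V -> V) z : differentiable f z ->
  grad f z = \matrix_(a, b) 'D_(basis R b) f z a 0.
Proof. by move=> df; apply/matrixP => a b; rewrite !mxE derive_entry. Qed.

Lemma grad_mul (f : V -> V) z (v : V) : differentiable f z -> grad f z *m v = 'D_v f z.
Proof.
move=> df; apply/matrixP => a i; rewrite (ord1 i) derive_basis// gradE// mxE summxE.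
by apply: eq_bigr => b _; rewrite !mxE mulrC.
Qed.

End SmoothFields.

(** * The pre-Lie algebra of smooth vector fields *)

Section PreLie.
Variables (R : realType) (n : nat).
Local Notation V := 'cV[R]_n.

(** Bundling smoothness makes partial derivatives and pre-Lie products total operations, and by
    [field_ext] pointwise identities become equalities usable under them. *)
Record field := Field { fval :> V -> V; field_smooth : smooth fval }.

Implicit Types (f g : field) (z : V).

Lemma field_ext (f g : field) : f =1 g -> f = g.
Proof.
case: f g => [f sf] [g sg] /= /funext fg; case: _ / fg in sg *.
by congr Field; exact: Prop_irrelevance.
Qed.

Lemma field_diff (f : field) z : differentiable f z.
Proof. exact/smooth_diff/field_smooth. Qed.

Definition fpartial b (f : field) : field := Field (smooth_partial b (field_smooth f)).

Definition fmul b (f g : field) : field :=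
  Field (smooth_mul b (field_smooth f) (field_smooth g)).

Definition fsum (I : Type) (s : seq I) (F : I -> field) : field :=
  Field (smooth_sum s (fun i => field_smooth (F i))).

Lemma fsumE (I : Type) (s : seq I) (F : I -> field) z : fsum s F z = \sum_(i <- s) F i z.
Proof. by []. Qed.

Definition fscale c (f : field) : field := Field (smoothZ c (field_smooth f)).

Lemma fpartialC b c f : fpartial b (fpartial c f) = fpartial c (fpartial b f).
Proof. by apply: field_ext => z; apply: partialC; exact: field_smooth. Qed.

Lemma fpartial_sum (I : Type) (s : seq I) (F : I -> field) b :
  fpartial b (fsum s F) = fsum s (fun i => fpartial b (F i)).
Proof.
apply: field_ext => z /=; rewrite derive_basis; last exact: (field_diff (fsum s F)).
elim: s => [|i s IH].
  rewrite big_nil big1// => c _.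
  rewrite (_ : (fun y => _) = cst 0) ?derive_cst ?scaler0//.
  by apply/funext => y; rewrite big_nil.
rewrite big_cons -{}IH -derive_basis; last exact: (field_diff (fsum (i :: s) F)).
rewrite -derive_basis; last exact: (field_diff (fsum s F)).
rewrite (_ : (fun y => _) = fval (F i) + fval (fsum s F)); last first.
  by apply/funext => y; rewrite /= big_cons.
by rewrite deriveD//; apply: diff_derivable; exact: field_diff.
Qed.

Lemma fpartialZ c (f : field) b : fpartial b (fscale c f) = fscale c (fpartial b f).
Proof.
by apply: field_ext => z /=; rewrite deriveZ//; exact/diff_derivable/field_diff.
Qed.

Lemma fpartial_mul a b f g z :
  fpartial b (fmul a f g) z = fmul a (fpartial b f) g z + fmul a f (fpartial b g) z.
Proof. by apply: derive_comp_mul; exact: field_diff. Qed.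

(* The pre-Lie product: the derivative of [g] along [f]. *)
Definition fgraft (f g : field) : field :=
  fsum (enum 'I_n) (fun b => fmul b f (fpartial b g)).

Lemma fgraftE f g z : fgraft f g z = \sum_b f z b 0 *: fpartial b g z.
Proof. by rewrite /= big_enum. Qed.

Lemma fgraft_grad f g z : fgraft f g z = grad g z *m f z.
Proof.
by rewrite fgraftE grad_mul ?derive_basis//; exact: field_diff.
Qed.

Lemma fgraft_sumr (I : Type) (s : seq I) f (F : I -> field) z :
  fgraft f (fsum s F) z = \sum_(i <- s) fgraft f (F i) z.
Proof.
rewrite fgraftE; under eq_bigr do rewrite fpartial_sum /= scaler_sumr.
by rewrite exchange_big; apply: eq_bigr => i _; rewrite fgraftE.
Qed.

Lemma fgraft_suml (I : Type) (s : seq I) g (F : I -> field) z :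
  fgraft (fsum s F) g z = \sum_(i <- s) fgraft (F i) g z.
Proof.
rewrite fgraftE; under eq_bigr do rewrite fsumE summxE scaler_suml.
by rewrite exchange_big; apply: eq_bigr => i _; rewrite fgraftE.
Qed.

Lemma fgraftZr c f g z : fgraft f (fscale c g) z = c *: fgraft f g z.
Proof.
rewrite !fgraftE scaler_sumr; apply: eq_bigr => b _.
by rewrite fpartialZ /= !scalerA mulrC.
Qed.

Lemma fgraftZl c f g z : fgraft (fscale c f) g z = c *: fgraft f g z.
Proof.
rewrite !fgraftE scaler_sumr; apply: eq_bigr => b _.
by rewrite scalerA mxE.
Qed.

(* [mder [:: f_1; ..; f_k] g] is the k-th derivative of [g] applied to the values
   of f_1, .., f_k, which are not themselves differentiated. *)
Fixpoint mder (fs : seq field) (g : field) : field :=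
  if fs is f :: fs' then fsum (enum 'I_n) (fun b => fmul b f (mder fs' (fpartial b g)))
  else g.

Lemma mder_cons f fs g z :
  mder (f :: fs) g z = \sum_b f z b 0 *: mder fs (fpartial b g) z.
Proof. by rewrite /= big_enum. Qed.

Lemma mder_swap f1 f2 fs g z : mder (f1 :: f2 :: fs) g z = mder (f2 :: f1 :: fs) g z.
Proof.
rewrite !mder_cons; under eq_bigr do rewrite mder_cons scaler_sumr.
under [RHS]eq_bigr do rewrite mder_cons scaler_sumr.
rewrite exchange_big; apply: eq_bigr => b _; apply: eq_bigr => c _.
by rewrite fpartialC !scalerA mulrC.
Qed.

Lemma mder_front f s1 s2 g z : mder (s1 ++ f :: s2) g z = mder (f :: s1 ++ s2) g z.
Proof.
elim: s1 g z => [//|f1 s1 IH] g z.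
rewrite cat_cons mder_cons; under eq_bigr do rewrite IH.
by rewrite -mder_cons mder_swap.
Qed.

Lemma mder_perm (T : eqType) (F : T -> field) (s s' : seq T) g :
  perm_eq s s' -> mder (map F s) g = mder (map F s') g.
Proof.
elim: s s' g => [|x s IH] s' g; first by move/perm_size/esym/size0nil ->.
move=> ss'; have xs' : x \in s' by rewrite -(perm_mem ss') mem_head.
apply: field_ext => z; move: ss'; case/splitPr: xs' => s1 s2.
rewrite perm_sym perm_catC /= perm_cons perm_catC perm_sym => ss'.
rewrite map_cat /= mder_front mder_cons; under eq_bigr do rewrite (IH _ _ ss').
by rewrite -mder_cons map_cat.
Qed.

Lemma mder_add (I : Type) (r : seq I) (F : I -> field) s1 s2 g z :
  mder (s1 ++ fsum r F :: s2) g z = \sum_(i <- r) mder (s1 ++ F i :: s2) g z.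
Proof.
rewrite mder_front mder_cons; under eq_bigr do rewrite fsumE summxE scaler_suml.
by rewrite exchange_big; apply: eq_bigr => i _; rewrite mder_front mder_cons.
Qed.

(** [f] differentiates either [g] once more or one of the coefficient fields. Solved for its first
    term, this is the recursion that defines the action of a forest on a tree. *)
Lemma mder_leibniz f fs g z :
  fgraft f (mder fs g) z = mder (f :: fs) g z +
    \sum_(i < size fs) mder (set_nth f fs i (fgraft f (nth f fs i))) g z.
Proof.
elim: fs g z => [|f1 fs IH] g z; first by rewrite big_ord0 addr0.
rewrite big_ord_recl [nth _ _ _]/= [set_nth _ _ _ _]/=.
transitivity (mder (fgraft f f1 :: fs) g z +
    \sum_b f1 z b 0 *: fgraft f (mder fs (fpartial b g)) z).
  rewrite [mder (f1 :: fs) g]/= fgraft_sumr big_enum mder_cons -big_split.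
  apply: eq_bigr => b _; rewrite !fgraftE summxE scaler_suml scaler_sumr -big_split.
  apply: eq_bigr => c _; rewrite fpartial_mul scalerDr mxE !scalerA.
  by congr (_ + _); rewrite /= ?scalerA// mulrC.
have -> : \sum_b f1 z b 0 *: fgraft f (mder fs (fpartial b g)) z =
    mder (f :: f1 :: fs) g z +
    \sum_(i < size fs) mder (f1 :: set_nth f fs i (fgraft f (nth f fs i))) g z.
  rewrite mder_swap mder_cons; under [X in _ = _ + X]eq_bigr do rewrite mder_cons.
  rewrite exchange_big -big_split; apply: eq_bigr => b _.
  by rewrite IH scalerDr; congr (_ + _); rewrite scaler_sumr.
by rewrite addrCA.
Qed.

End PreLie.

(** * Elementary differentials of trees as a pre-Lie morphism *)

Section ElementaryDifferentials.
Variables (R : realType) (n d : nat) (sigma : 'I_d -> 'cV[R]_n -> 'cV[R]_n).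
Hypothesis smooth_sigma : forall j, smooth (sigma j).
Local Notation V := 'cV[R]_n.
Local Notation field := (field R n).

Lemma big_tuple_cons (T : finType) (W : nmodType) k (F : k.+1.-tuple T -> W) :
  \sum_(i : k.+1.-tuple T) F i = \sum_x \sum_(i : k.-tuple T) F [tuple of x :: i].
Proof.
rewrite pair_big /= (reindex (fun p : T * k.-tuple T => [tuple of p.1 :: p.2])) //=.
exists (fun t => (thead t, [tuple of behead t])) => [[x t] _|t _] /=.
  by congr pair; apply: val_inj.
by rewrite -tuple_eta.
Qed.

Lemma ptree_nested_ind (P : ptree d -> Prop) :
  (forall i s, (forall u, u \in s -> P u) -> P (PNode i s)) -> forall t, P t.
Proof.
move=> HP; fix F 1 => -[i s]; apply: HP.
elim: s => [|u s IH] v; first by rewrite in_nil => vn; discriminate vn.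
rewrite in_cons => /orP[/eqP->|]; [exact: F|exact: IH].
Qed.

Definition sigma_field j : field := Field (smooth_sigma j).

Fixpoint pfield (t : ptree d) : field :=
  let: PNode j s := t in mder [seq pfield u | u <- s] (sigma_field j).

Lemma smooth_partials (f : V -> V) s : smooth f -> smooth (partials f s).
Proof. by move=> sf; elim: s => //= b s; exact: smooth_partial. Qed.

(** [partials] applies its first index outermost, [mder] innermost; symmetry of second derivatives
    reconciles the two orders. *)
Lemma partials_fpartial (g : field) b (i : seq 'I_n) z :
  partials (fpartial b g) i z = 'D_(basis R b) (partials g i) z.
Proof.
elim: i z => [//|c i IH] z /=.
rewrite (_ : partials _ _ = fun z => 'D_(basis R b) (partials g i) z).
  by apply: partialC; apply: smooth_partials; exact: field_smooth.
by apply/funext => y; exact: IH.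
Qed.

Lemma mder_partials (fs : seq field) k (g : field) z : size fs = k ->
  mder fs g z = \sum_(i : k.-tuple 'I_n)
     (\prod_(yi <- zip [seq fval f z | f <- fs] i) yi.1 yi.2 0) *: partials g i z.
Proof.
elim: fs k g => [|f fs IH] k g /= <-.
  rewrite (big_pred1 [tuple]) => [|t]; last by apply/esym/eqP; exact: tuple0.
  by rewrite big_nil scale1r.
rewrite big_tuple_cons -[LHS]/(mder (f :: fs) g z) mder_cons; apply: eq_bigr => b _.
rewrite (IH (size fs))// scaler_sumr; apply: eq_bigr => i _.
by rewrite big_cons scalerA partials_fpartial.
Qed.

Lemma pelemE t z : pelem sigma t z = pfield t z.
Proof.
elim/ptree_nested_ind: t => j s IH /=.
rewrite (@mder_partials _ (size s)) ?size_map// -map_comp.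
by apply: eq_bigr => i _; congr ((\prod_(yi <- zip _ i) _) *: _); apply/eq_in_map => u us; exact: IH.
Qed.

(** Higher derivatives are symmetric, so the order of the children is irrelevant and the field
    descends to non-planar trees. *)
Lemma pfield_piso p q : piso p q -> pfield p = pfield q.
Proof.
elim=> {p q} [//|t u _ ->//|t u v _ -> _ ->//|i s s' ss'|i s1 s2 t u _ tu] /=.
  exact: mder_perm.
by rewrite !map_cat /= tu.
Qed.

Definition tfield (t : tree d) : field := pfield (repr t).

Lemma elemE t z : elem sigma t z = tfield t z.
Proof. exact: pelemE. Qed.

Lemma tfield_pi p : tfield (\pi_(tree d) p)%qT = pfield p.
Proof.
apply: pfield_piso; apply/asboolP.
by have /eqmodP := reprK (\pi_(tree d) p)%qT.
Qed.

(** The two kinds of terms of [mder_leibniz] are the two ways to graft: on the root of [u], or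
    inside one of its branches. *)
Lemma pgraft_field t u z :
  \sum_(p <- pgraft t u) pfield p z = fgraft (pfield t) (pfield u) z.
Proof.
elim/ptree_nested_ind: u => i s IH.
rewrite -[pfield (PNode i s)]/(mder [seq pfield u | u <- s] (sigma_field i)).
rewrite [pgraft _ _]/= big_cons big_map mder_leibniz; congr (_ + _).
rewrite -[LHS]/(\sum_(w <- _) mder [seq pfield u | u <- w] (sigma_field i) z).
elim: s (sigma_field i) IH => [|v s IHs] g IH; first by rewrite big_nil big_ord0.
rewrite [X in index_enum X]/= big_cat !big_map big_ord_recl; congr (_ + _).
  rewrite [RHS]mder_cons; under eq_bigr do rewrite mder_cons.
  rewrite exchange_big; apply: eq_bigr => b _.
  by rewrite -IH ?mem_head// summxE scaler_suml.
transitivity (\sum_b pfield v z b 0 *: \sum_(i < size (map pfield s))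
  mder (set_nth (pfield t) (map pfield s) i
    (fgraft (pfield t) (nth (pfield t) (map pfield s) i))) (fpartial b g) z).
  under [RHS]eq_bigr => b _.
    rewrite -IHs; last by move=> u us; apply: IH; rewrite in_cons us orbT.
    over.
  under eq_bigr do rewrite mder_cons.
  by rewrite exchange_big; apply: eq_bigr => b _; rewrite scaler_sumr.
under eq_bigr do rewrite scaler_sumr.
by rewrite exchange_big; apply: eq_bigr => k _; rewrite [RHS]mder_cons.
Qed.

End ElementaryDifferentials.

(** * Linear combinations of trees and the action of forests *)

HB.instance Definition _ (R : realType) (K : choiceType) (M : lmodType R) (f : K -> M) :=
  GRing.isZmodMorphism.Build {freeg K / R} M (fglift f) (lift_is_additive f).

Section LinearCombinations.
Variables (R : realType) (n d : nat) (sigma : 'I_d -> 'cV[R]_n -> 'cV[R]_n).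
Hypothesis smooth_sigma : forall j, smooth (sigma j).
Local Notation V := 'cV[R]_n.
Local Notation field := (field R n).
Local Notation tfield := (tfield smooth_sigma).

Lemma fgliftE (K : choiceType) (M : lmodType R) (f : K -> M) (D : {freeg K / R}) :
  fglift f D = \sum_(x <- fgenum D) x.1 *: f x.2.
Proof. by rewrite -{1}(Freeg_enum D) fglift_Freeg. Qed.

Lemma fgliftZ (K : choiceType) (M : lmodType R) (f : K -> M) c (D : {freeg K / R}) :
  fglift f (c *: D) = c *: fglift f D.
Proof.
have -> : fglift f D = \sum_(x <- dom D) coeff x D *: f x.
  by rewrite -{1}(freeg_sumE D) raddf_sum; apply: eq_bigr => x _; exact: liftU.
rewrite [c *: D]/(fgscale c D) /fgscale raddf_sum scaler_sumr.
by apply: eq_bigr => x _; rewrite /= liftU scalerA.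
Qed.

Definition lcfield (x : lc R d) : field :=
  fsum (fgenum x) (fun p => fscale p.1 (tfield p.2)).

Lemma elem_lcE x z : elem_lc sigma x z = lcfield x z.
Proof.
by rewrite /elem_lc fgliftE; apply: eq_bigr => p _; rewrite (elemE smooth_sigma).
Qed.

Lemma elem_lc_fglift (K : choiceType) (F : K -> lc R d) (x : {freeg K / R}) z :
  elem_lc sigma (fglift F x) z = \sum_(p <- fgenum x) p.1 *: elem_lc sigma (F p.2) z.
Proof.
rewrite /elem_lc [fglift F x]fgliftE raddf_sum; apply: eq_bigr => p _; exact: fgliftZ.
Qed.

Lemma elem_lcB m (x : lc R d) (F : 'I_m -> lc R d) z :
  elem_lc sigma (x - \sum_i F i) z =
  elem_lc sigma x z - \sum_i elem_lc sigma (F i) z.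
Proof. by rewrite /elem_lc raddfB raddf_sum. Qed.

Lemma lcfieldU t : lcfield << t >> = tfield t.
Proof.
by apply: field_ext => z; rewrite -elem_lcE /elem_lc liftU scale1r (elemE smooth_sigma).
Qed.

Lemma elem_lc_graft t u z :
  elem_lc sigma (graft R t u) z = fgraft (tfield t) (tfield u) z.
Proof.
rewrite /elem_lc raddf_sum -pgraft_field; apply: eq_bigr => p _.
by rewrite /= liftU scale1r (elemE smooth_sigma) tfield_pi.
Qed.

Lemma lcfield_graft t u : lcfield (graft R t u) = fgraft (tfield t) (tfield u).
Proof. by apply: field_ext => z; rewrite -elem_lcE elem_lc_graft. Qed.

Lemma lcfield_graft_lc x y : lcfield (graft_lc x y) = fgraft (lcfield x) (lcfield y).
Proof.
apply: field_ext => z; rewrite -elem_lcE /graft_lc elem_lc_fglift fgraft_suml.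
apply: eq_bigr => p _; rewrite elem_lc_fglift fgraftZl fgraft_sumr; congr (_ *: _).
by apply: eq_bigr => q _; rewrite elem_lc_graft fgraftZr.
Qed.

Fixpoint bfield (fs : nat -> field) (r : btree) : field :=
  match r with
  | BLeaf a => fs a
  | BNode r1 r2 => fgraft (bfield fs r1) (bfield fs r2)
  end.

Lemma lcfield_Gtree taus r : lcfield (Gtree R taus r) = bfield (tfield \o taus) r.
Proof.
elim: r => [a|r1 IH1 r2 IH2] /=; first exact: lcfieldU.
by rewrite lcfield_graft_lc IH1 IH2.
Qed.

Lemma mder_scale c f s1 s2 (g : field) z :
  mder (s1 ++ fscale c f :: s2) g z = c *: mder (s1 ++ f :: s2) g z.
Proof.
rewrite !mder_front !mder_cons scaler_sumr; apply: eq_bigr => b _.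
by rewrite /= mxE scalerA.
Qed.

(** The recursion subtracts exactly the terms in which a coefficient field is differentiated, so
    only the pure higher derivative remains. *)
Lemma lcfield_graft_rec N s u : (size s <= N)%N ->
  lcfield (graft_rec R N s u) = mder (map tfield s) (tfield u).
Proof.
elim: N s => [|N IH] [|t s] //= sN; try exact: lcfieldU.
apply: field_ext => z; rewrite -elem_lcE elem_lcB.
rewrite -/(mder (tfield t :: map tfield s) (tfield u)).
apply/eqP; rewrite subr_eq; apply/eqP; rewrite elem_lc_fglift.
transitivity (fgraft (tfield t) (lcfield (graft_rec R N s u)) z).
  rewrite fgraft_sumr; apply: eq_bigr => p _.
  by rewrite elem_lc_graft fgraftZr.
rewrite IH// mder_leibniz size_map; congr (_ + _); apply: eq_bigr => i _.
have is_ : (i < size s)%N by [].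
rewrite elem_lc_fglift (nth_map t)// -lcfield_graft.
rewrite set_nthE size_map is_ mder_add; apply: eq_bigr => p _.
rewrite mder_scale elem_lcE IH; last by rewrite size_set_nth (maxn_idPr _).
by rewrite set_nthE is_ map_cat /= map_take map_drop.
Qed.

Lemma elem_lc_graft_forest (w : forest d) u z :
  elem_lc sigma (graft_forest R w u) z =
  mder (map tfield (enum_mset w)) (tfield u) z.
Proof. by rewrite elem_lcE lcfield_graft_rec. Qed.

End LinearCombinations.

(** * Planar binary trees and the inversion of V^- *)

Section BinaryTrees.
Implicit Types (r q x : btree) (s : seq btree).

Lemma comb_cat x s1 s2 : comb x (s1 ++ s2) = comb (comb x s2) s1.
Proof. exact: foldr_cat. Qed.

Lemma spine_comb x s : spine (comb x s) = s ++ spine x.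
Proof. by elim: s => //= q s ->. Qed.

Lemma left_leaf_comb x s : left_leaf (comb x s) = left_leaf x.
Proof. by elim: s. Qed.

Lemma comb_spine r : comb (BLeaf (left_leaf r)) (spine r) = r.
Proof. by elim: r => //= r1 -> r2. Qed.

Lemma comb_Psub r l : comb (Psub r l) (take l.-1 (spine r)) = r.
Proof. by rewrite /Psub -comb_cat cat_take_drop comb_spine. Qed.

Lemma size_cut r l : (0 < l <= (mL r).+1)%N -> size (cut r l) = l.
Proof.
case: l => [//|l] /= lr; rewrite /cut size_rcons size_take.
by move: lr; rewrite /mL ltnS leq_eqVlt => /orP[/eqP->|->]; rewrite ?ltnn.
Qed.

Lemma cut1 r : cut r 1 = [:: r].
Proof. by rewrite /cut /Psub /= take0 drop0 comb_spine. Qed.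

(** The new leaf [a] becomes the left sibling of [Psub r l], the subtree at depth l - 1 on the left
    edge of [r]. With [l] recovered as the new left depth, this inverts [Vminus]. *)
Definition extend a r l := comb (BLeaf a) (cut r l).

Lemma spine_extend a r l : spine (extend a r l) = cut r l.
Proof. by rewrite spine_comb cats0. Qed.

Lemma mL_extend a r l : (0 < l <= (mL r).+1)%N -> mL (extend a r l) = l.
Proof. by move=> lr; rewrite /mL spine_extend size_cut. Qed.

Lemma Vminus_extend a r l : (0 < l <= (mL r).+1)%N -> Vminus (extend a r l) = r.
Proof.
move=> lr; rewrite /Vminus mL_extend// spine_extend /cut last_rcons.
rewrite -cats1 take_cat size_take -/(mL r).
have -> : (if (l.-1 < mL r)%N then l.-1 else mL r) = l.-1 by case: ifP; lia.
by rewrite ltnn subnn cats0 comb_Psub.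
Qed.

Lemma bleaves_comb x s : bleaves (comb x s) = bleaves x ++ flatten [seq bleaves q | q <- rev s].
Proof.
elim: s => [|q s IH] /=; first by rewrite cats0.
by rewrite IH rev_cons map_rcons flatten_rcons catA.
Qed.

Lemma bleaves_extend a r l : bleaves (extend a r l) = a :: bleaves r.
Proof.
rewrite /extend /cut bleaves_comb rev_rcons /=.
by rewrite -bleaves_comb comb_Psub.
Qed.

Lemma extend_Vminus r : (0 < mL r)%N ->
  [/\ (0 < mL r <= (mL (Vminus r)).+1)%N &
      extend (left_leaf r) (Vminus r) (mL r) = r].
Proof.
rewrite /Vminus /mL; case/lastP Es : (spine r) => [//|s q] _.
rewrite last_rcons size_rcons /= -cats1 take_size_cat// spine_comb size_cat.
split; first by rewrite ltnS leq_addr.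
rewrite /extend /cut spine_comb /= take_size_cat// /Psub left_leaf_comb spine_comb /=.
by rewrite drop_size_cat// comb_spine -Es comb_spine.
Qed.

Lemma mR_spine r : mR r = if spine r is q :: _ then (mR q).+1 else 0.
Proof. by case: r. Qed.

(** Only for [l = 1] is the result [[a, r]], with a longer right edge. Otherwise the exponent k -
    m_R grows by one: this produces the signs below. *)
Lemma mR_extend a r l : (0 < l <= (mL r).+1)%N ->
  mR (extend a r l) = if l == 1%N then (mR r).+1 else mR r.
Proof.
case: l => [//|[|l]] lr; first by rewrite mR_spine spine_extend cut1.
rewrite mR_spine spine_extend [RHS]mR_spine /cut /=; move: lr; rewrite /mL.
by case: (spine r).
Qed.

(* The trees with leaves [ls ++ [:: 0]] from left to right. *)
Fixpoint trees_with_leaves (ls : seq nat) : seq btree :=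
  if ls is a :: ls' then
    [seq extend a r l | r <- trees_with_leaves ls', l <- index_iota 1 (mL r).+2]
  else [:: BLeaf 0].

Lemma bleaves_size r : (0 < size (bleaves r))%N.
Proof. by elim: r => //= r1 IH r2 _; rewrite size_cat ltn_addr. Qed.

Lemma mR_lt r : (mR r < size (bleaves r))%N.
Proof.
elim: r => //= r1 _ r2 IH; rewrite size_cat -add1n; apply: leq_add => //.
exact: bleaves_size.
Qed.

Lemma bleaves_left r : bleaves r = left_leaf r :: behead (bleaves r).
Proof. by elim: r => //= r1 -> r2 _. Qed.

Lemma mem_trees_with_leaves ls r : (r \in trees_with_leaves ls) = (bleaves r == rcons ls 0).
Proof.
elim: ls r => [|a ls IH] r.
  rewrite inE; case: r => [a|r1 r2] /=; apply/eqP/eqP; [by case=> ->|by case=> ->|by []|].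
  move=> /(congr1 size)/=; rewrite size_cat.
  by have := bleaves_size r1; have := bleaves_size r2; lia.
apply/allpairsPdep/eqP => [[q [l [+ + ->]]]|E].
  by rewrite IH mem_index_iota ltnS => /eqP ql lq; rewrite bleaves_extend ql.
have r0 : (0 < mL r)%N.
  case: r E => [b|r1 r2]//= [] _ /(congr1 size); by rewrite size_rcons.
have [lr Er] := extend_Vminus r0.
have El : left_leaf r = a by move: E; rewrite bleaves_left => -[].
exists (Vminus r), (mL r); split; last by rewrite -El Er.
  by rewrite IH; move: E; rewrite -{1}Er bleaves_extend => -[_ ->].
by rewrite mem_index_iota ltnS.
Qed.

Lemma uniq_trees_with_leaves ls : uniq (trees_with_leaves ls).
Proof.
elim: ls => [//|a ls IH]; apply: allpairs_uniq_dep => //.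
  by move=> r _; exact: iota_uniq.
move=> p1 p2 /(@allpairsPdep _ (fun=> nat : eqType))[r1 [l1 [_ + ->]]].
move=> + /(@allpairsPdep _ (fun=> nat : eqType))[r2 [l2 [_ + ->]]] /=.
rewrite !mem_index_iota !ltnS => l1r l2r E.
have Er : r1 = r2 by rewrite -(Vminus_extend a l1r) E Vminus_extend.
have El : l1 = l2 by rewrite -(mL_extend a l1r) E mL_extend.
by rewrite Er El.
Qed.

End BinaryTrees.

(** * Sums over words of indices *)

Section Words.

(** Plain lists instead of tuples of ordinals: words can be cut, joined and compared over different
    alphabets without changing type. *)
Fixpoint words (k l : nat) : seq (seq nat) :=
  if l is l'.+1 then [seq a :: s | a <- iota 0 k, s <- words k l'] else [:: [::]].

Lemma mem_words k l s : (s \in words k l) = (size s == l) && all (fun a => a < k)%N s.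
Proof.
elim: l s => [|l IH] s; first by rewrite inE; case: s.
apply/allpairsP/andP => [[[a s'] /= [+ + ->]]|].
  by rewrite mem_iota IH eqSS /= => -> /andP[-> ->].
case: s => [[]//|a s] /= []; rewrite eqSS => sl /andP[ak sk].
by exists (a, s); rewrite mem_iota IH sl.
Qed.

Variable W : nmodType.

Lemma big_words_cons k l (F : seq nat -> W) :
  \sum_(s <- words k l.+1) F s = \sum_(0 <= a < k) \sum_(s <- words k l) F (a :: s).
Proof. by rewrite big_allpairs_dep /index_iota subn0. Qed.

Lemma big_words_cat k l1 l2 (F : seq nat -> W) :
  \sum_(s <- words k (l1 + l2)) F s =
  \sum_(s1 <- words k l1) \sum_(s2 <- words k l2) F (s1 ++ s2).
Proof.
elim: l1 F => [|l1 IH] F; first by rewrite big_seq1.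
rewrite addSn !big_words_cons; apply: eq_bigr => a _; exact: IH.
Qed.

Lemma big_words_rcons k l (F : seq nat -> W) :
  \sum_(s <- words k l.+1) F s = \sum_(s <- words k l) \sum_(0 <= b < k) F (rcons s b).
Proof.
rewrite -addn1 big_words_cat; apply: eq_bigr => s _.
rewrite big_words_cons; apply: eq_bigr => b _.
by rewrite big_seq1 cats1.
Qed.

Lemma big_words_restrict k l (F : seq nat -> W) :
  \sum_(s <- words k l) F s =
  \sum_(s <- words k.+1 l | all (fun a => a < k)%N s) F s.
Proof.
elim: l F => [|l IH] F; first by rewrite !big_cons !big_nil.
rewrite big_words_cons [RHS]big_mkcond big_words_cons big_nat_recr//=.
rewrite [X in _ + X]big1 ?addr0; last by move=> s _; rewrite ltnn.
rewrite !big_nat; apply: eq_bigr => a /andP[_ ak].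
by rewrite IH big_mkcond; apply: eq_bigr => s _; rewrite /= ak.
Qed.

Lemma big_tuple_words k l (P : pred (seq nat)) (F : seq nat -> W) :
  \sum_(i : l.-tuple 'I_k | P (map val i)) F (map val i) = \sum_(s <- words k l | P s) F s.
Proof.
rewrite big_mkcond [RHS]big_mkcond.
suff sumG (G : seq nat -> W) : \sum_(i : l.-tuple 'I_k) G (map val i) = \sum_(s <- words k l) G s.
  exact: (sumG (fun s => if P s then F s else 0)).
elim: l G => [|l IH] G.
  rewrite (big_pred1 [tuple]) => [|t]; last by apply/esym/eqP; exact: tuple0.
  by rewrite big_seq1.
rewrite big_tuple_cons big_words_cons big_mkord; apply: eq_bigr => a _.
exact: (IH (fun s => G (val a :: s))).
Qed.

End Words.

Lemma path_ltn_all K x s : path ltn x s -> (last x s < K)%N -> all (fun a => a < K)%N (x :: s).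
Proof.
elim: s x => [|y s IH] x /=; first by move=> _ ->.
move=> /andP[xy ys] sK; have /= /andP[yK ->] := IH _ ys sK.
by rewrite (ltn_trans xy yK) yK.
Qed.

(** * The recursion for J as a count of insertions *)

Section JSum.
Variables (R : realType) (W : lmodType R).

Lemma size_bleaves_Vminus r : (0 < mL r)%N -> size (bleaves r) = (size (bleaves (Vminus r))).+1.
Proof. by case/extend_Vminus => _ {1}<-; rewrite bleaves_extend. Qed.

Lemma J_unfold r j : (0 < mL r)%N ->
  let M := mL r in let K := (size (bleaves r)).-1 in
  J r j = if size j == 1%N then
      (\sum_(i <- words K M | sorted ltn i) (head 0 i < head 0 j) * J (Vminus r) i)%N
    else if (size j <= M)%N then
      (\sum_(i <- words K (M - size j).+1 | sorted ltn i)
         (last 0 j <= head 0 i) * J (Vminus r) (take (size j).-1 j ++ i))%N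
    else J (Vminus r) (take M j).
Proof.
move=> r0 M K; rewrite -!(@big_tuple_words _ _ _ (sorted ltn)) {}/M {}/K.
rewrite /J (size_bleaves_Vminus r0) /=.
case E : (size (bleaves (Vminus r))) => [|k] /=.
  by have := bleaves_size (Vminus r); rewrite E.
by [].
Qed.

(* The positions at which the integration variable of the subtree P_(r,l) may be
   inserted into the increasing sequence i of positions. *)
Definition insertable K (i : seq nat) l b :=
  ((nth 0 i l.-2 < b) && (b <= (if l == 1 then K else nth K i l.-1)))%N.

(** Exchanging the sums, each old index word [i] contributes once for every admissible position [b]
    of the new variable. The indices of [i] from rank l on are dropped, as their subtrees are
    absorbed into the new one. *)
Lemma sum_J r l (Phi : seq nat -> W) : (0 < mL r)%N -> (0 < l <= (mL r).+1)%N ->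
  let K := (size (bleaves r)).-1 in
  \sum_(j <- words K.+1 l | sorted ltn j) (J r j)%:R *: Phi j =
  \sum_(i <- words K (mL r) | sorted ltn i) (J (Vminus r) i)%:R *:
    \sum_(0 <= b < K.+1 | insertable K i l b) Phi (rcons (take l.-1 i) b).
Proof.
move=> r0 /andP[l0 lM] K; set M := mL r; set V := Vminus r.
have M0 : (0 < M)%N by [].
case: l l0 lM => [//|[|p]] _ lM.
- rewrite big_mkcond big_words_cons.
  under eq_bigr => b _.
    rewrite big_seq1 /= J_unfold//= natr_sum scaler_suml.
    over.
  rewrite exchange_big; apply: eq_bigr => i _.
  rewrite scaler_sumr [RHS]big_mkcond !big_nat; apply: eq_bigr => b /andP[_ bK].
  rewrite ltnS in bK; rewrite /insertable /= nth0 bK andbT natrM mulrC -scalerA.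
  case: (head 0 i < b)%N; last by rewrite scale0r scaler0.
  by rewrite scale1r take0.
- rewrite ltnS in lM; have [pM|Mp] := ltnP p.+1 M.
  (* For 2 <= l <= M, split [i] into its first l - 1 letters, kept in [j], and the rest, summed over
     inside J. *)
  + rewrite big_mkcond big_words_rcons.
    have EM : M = (p.+1 + (M - p.+2).+1)%N by rewrite addnS -addSn subnKC.
    rewrite [in RHS]EM [RHS]big_mkcond [RHS]big_words_cat [RHS]big_words_restrict [RHS]big_mkcond.
    rewrite !big_seq; apply: eq_bigr => s1; rewrite mem_words => /andP[/eqP s1p s1K].
    transitivity (\sum_(0 <= b < K.+1) \sum_(0 <= a < K) \sum_(s2 <- words K (M - p.+2))
      (if [&& sorted ltn (rcons s1 b), sorted ltn (a :: s2) & (b <= a)%N]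
       then (J V (s1 ++ a :: s2))%:R *: Phi (rcons s1 b) else 0)).
      apply: eq_bigr => b _; rewrite J_unfold//= size_rcons s1p /= -/M pM.
      case: ifP => [sb|_] /=; last first.
        by rewrite big1// => a _; rewrite big1.
      rewrite natr_sum scaler_suml big_mkcond big_words_cons.
      apply: eq_bigr => a _; apply: eq_bigr => s2 _ /=.
      rewrite last_rcons -cats1 -s1p take_size_cat//.
      case: ifP => //= _; case: (b <= a)%N; rewrite ?mul1n// mul0n scale0r//.
    rewrite exchange_big /=.
    (* A prefix containing the letter [K] contributes nothing: it must increase strictly up to [b],
       and [b <= a < K]. *)
    case: ifP => [s1K'|s1K']; last first.
      rewrite big_nat big1// => a /andP[_ aK]; rewrite big1// => b _.
      rewrite big1// => s2 _; case: ifP => // /and3P[+ _ ba].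
      case: s1 s1p s1K s1K' => [//|x s1] _ _ s1K' /=.
      rewrite rcons_path => /andP[xs sb].
      by move: s1K'; rewrite (path_ltn_all xs (leq_trans (leq_trans sb ba) (ltnW aK))).
    rewrite big_words_cons !big_nat; apply: eq_bigr => a /andP[_ aK].
    rewrite exchange_big; apply: eq_bigr => s2 _ /=.
    case: s1 s1p s1K s1K' => [//|x s1] [s1p] s1K s1K'.
    rewrite [X in if X then _ else 0]/= cat_path /=.
    transitivity (\sum_(0 <= b < K.+1) if [&& path ltn x s1, (last x s1 < a)%N & path ltn a s2]
      && insertable K (x :: s1 ++ a :: s2) p.+2 b then
        (J V (x :: s1 ++ a :: s2))%:R *: Phi (rcons (x :: s1) b) else 0).
      apply: eq_bigr => b _; congr (if _ then _ else _).
      rewrite /insertable /= rcons_path -cat_cons nth_cat /= s1p ltnSn.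
      rewrite -{1}s1p nth_last /= nth_cat s1p ltnn subnn /=.
      case: (path ltn x s1) => //=; case: (path ltn a s2); rewrite ?andbF//= ?andbT.
      by apply/andP/and3P => [[sb ba]|[_ ? ?]]//; split => //; exact: leq_trans ba.
    case: ifP => _ /=; last by rewrite big1.
    rewrite -big_mkcond scaler_sumr; apply: eq_bigr => b _.
    by rewrite -cat_cons take_size_cat//= s1p.
  (* For l = M + 1 no index is dropped, and the upper bound in [insertable] is the default value [K]
     of [nth]. *)
  + have {Mp lM} Mp : M = p.+1 by apply/eqP; rewrite eqn_leq Mp.
    rewrite [in RHS]Mp big_mkcond big_words_rcons [RHS]big_mkcond [RHS]big_words_restrict [RHS]big_mkcond.
    rewrite !big_seq; apply: eq_bigr => s1; rewrite mem_words => /andP[/eqP s1p s1K].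
    case: s1 s1p s1K => [//|x s1] [s1p] s1K.
    rewrite -[sorted _ _ in RHS]/(path ltn x s1).
    transitivity (\sum_(0 <= b < K.+1) if path ltn x s1 && (last x s1 < b)%N then
       (J V (x :: s1))%:R *: Phi (rcons (x :: s1) b) else 0).
      apply: eq_bigr => b _; rewrite /= rcons_path; case: ifP => // _.
      rewrite J_unfold//= size_rcons /= s1p -/M Mp ltnn.
      by rewrite -s1p /= -cats1 take_size_cat.
    case: (boolP (path ltn x s1)) => [xs|_] /=; last first.
      by rewrite big1//; case: ifP.
    case: ifP => [s1K'|s1K']; last first.
      rewrite big_nat big1// => b /andP[_ bK]; case: ifP => // sb.
      have := path_ltn_all xs (leq_trans sb bK); rewrite /= s1K'.
      by [].
    rewrite -big_mkcond scaler_sumr big_nat_cond [RHS]big_nat_cond.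
    apply: eq_big => [b|b _]; last by rewrite -s1p take_size.
    rewrite /insertable /= -{1}s1p nth_last /= nth_default ?s1p//=.
    by rewrite ltnS; case: (b <= K)%N; rewrite ?andbF ?andbT.
Qed.

End JSum.

Lemma sum_nat_recr (W : nmodType) m n (F : nat -> W) : (m <= n)%N ->
  \sum_(m <= b < n.+1) F b = \sum_(m <= b < n) F b + F n.
Proof. exact: big_nat_recr. Qed.

Lemma sorted_rcons_ltn s x : sorted ltn (rcons s x) ->
  sorted ltn s && all (fun a => a < x)%N s.
Proof.
case: s => [//|y s]; rewrite /= rcons_path => /andP[ys sx].
by rewrite ys; exact: path_ltn_all.
Qed.

(** * Inserting an integration variable by parts *)

Section Insertion.
Variables (R : realType) (n : nat).

Implicit Types (js : seq nat) (As : seq (curve R n n)).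

(** One matrix per time slot: for [i] outside [js] the index is [size js], so that, with as many
    matrices as indices, [nth] falls back on the identity [cone]. *)
Definition place N (js : seq nat) (As : seq (curve R n n)) : seq (curve R n n) :=
  [seq nth cone As (seq.index i js) | i <- iota 0 N].

(* The integral over [t >= t_0 >= .. >= t_(k-1) >= 0] of the product of the matrices
   [As] taken at the times with indices [js] and of the vector [W] taken at [t_j],
   where j is larger than all the elements of [js] and [t_k] stands for 0. *)
Definition placed_int k js As (W : curve R n 1) j : curve R n 1 :=
  iter_int (place j js As) (insertc (k - j) W).

Lemma place_rcons N js As : place N.+1 js As = rcons (place N js As) (nth cone As (seq.index N js)).
Proof. by rewrite /place -[in LHS]addn1 iotaD map_cat cats1. Qed.

Lemma place_notin N js (As : seq (curve R n n)) : size As = size js -> N \notin js ->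
  nth cone As (seq.index N js) = cone.
Proof. by move=> sA Njs; rewrite memNindex// nth_default// sA. Qed.

Lemma eq_place N js js' As As' :
  (forall i, (i < N)%N -> nth cone As (seq.index i js) = nth cone As' (seq.index i js')) ->
  place N js As = place N js' As'.
Proof.
by move=> E; apply/eq_in_map => i; rewrite mem_iota => /E.
Qed.

Lemma all_ltn_notin N js : all (fun a => a < N)%N js -> N \notin js.
Proof. by move=> jsN; apply/negP => /(allP jsN); rewrite ltnn. Qed.

Lemma place_rcons_rcons N js j As A : size As = size js -> (N <= j)%N ->
  place N (rcons js j) (rcons As A) = place N js As.
Proof.
move=> sA Nj; apply: eq_place => i iN.
rewrite -(cats1 js) index_cat; case: ifP => ijs.
  by rewrite nth_rcons sA index_mem ijs.
rewrite /= gtn_eqF ?(leq_trans iN)// nth_default ?size_rcons ?sA ?addn1//.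
by rewrite place_notin// ijs.
Qed.

Lemma place_nil N : place N [::] [::] = nseq N cone.
Proof. by elim: N => [//|N IH]; rewrite place_rcons IH -cats1 -[N.+1]addn1 nseqD. Qed.

Lemma placed_int_parts k js As (W W' : curve R n 1) j t : mderive W W' -> (j <= k)%N ->
  placed_int k.+1 js As W' j t =
  iter_int (place j js As) (volc (k - j) W) t - placed_int k js As W j t.
Proof.
move=> dW jk; rewrite /placed_int subSn// -[RHS]addrC -scaleN1r addrC.
by apply: iter_int_comb => s; rewrite (insertc_parts _ _ dW) scaleN1r.
Qed.

(** If slot j is empty, the boundary term produced at position j + 1 is the term subtracted at
    position j; this makes the sums over positions telescope. *)
Lemma placed_int_skip k js As (W : curve R n 1) j t : (j < k)%N ->
  size As = size js -> j \notin js ->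
  iter_int (place j.+1 js As) (volc (k - j.+1) W) t = placed_int k js As W j t.
Proof.
move=> jk sA jjs; rewrite place_rcons -cats1 iter_int_cat place_notin// /placed_int (_ : k - j = (k - j.+1).+1)%N; last lia.
by apply: iter_int_ext => s; apply: mprim_ext => v; rewrite /= mul1mx.
Qed.

(** If slot j carries [A], the boundary term is multiplied by [A] instead; with [A] a gradient, this
    is where a pre-Lie product arises. *)
Lemma placed_int_last k js As A (W : curve R n 1) j t : (j < k)%N ->
  size As = size js -> j \notin js ->
  iter_int (place j.+1 (rcons js j) (rcons As A)) (volc (k - j.+1) W) t =
  placed_int k js As (cmul A W) j t.
Proof.
move=> jk sA jjs; rewrite place_rcons -cats1 iter_int_cat place_rcons_rcons//.
rewrite -(cats1 js) index_cat (negbTE jjs) /= eqxx addn0 nth_rcons sA ltnn eqxx.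
rewrite /placed_int (_ : k - j = (k - j.+1).+1)%N; last lia.
by apply: iter_int_ext => s; apply: mprim_ext => v; rewrite /= scalemxAr.
Qed.

(** This is W(t_i) - W(t_i') as the integral of W' from t_i' to t_i: [b] is the rank of the new time
    among the old ones, and the rank [i' = k] stands for time 0. *)
Lemma sum_placed_int k js As A (W W' : curve R n 1) i i' t : mderive W W' ->
  size As = size js -> all (fun a => a < i)%N js -> (i < i' <= k)%N ->
  \sum_(i.+1 <= b < i'.+1) placed_int k.+1 (rcons js i) (rcons As A) W' b t =
  placed_int k js As (cmul A W) i t - placed_int k (rcons js i) (rcons As A) W i' t.
Proof.
move=> dW sA jsi /andP[]; elim: i' => [//|i' IH]; rewrite ltnS leq_eqVlt.
move=> /orP[/eqP <-|ii'] ik.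
  rewrite big_nat1 (placed_int_parts _ _ _ dW)// placed_int_last//.
  exact: all_ltn_notin.
rewrite sum_nat_recr ?(leqW ii')// IH ?(ltnW ik)// (placed_int_parts _ _ _ dW)//.
rewrite placed_int_skip ?size_rcons ?sA//; first by rewrite addrA subrK.
rewrite all_ltn_notin// all_rcons ii'; apply/allP => a /(allP jsi) ai.
exact: ltn_trans ai ii'.
Qed.

Lemma sum_placed_int0 k (W W' : curve R n 1) i i' t : mderive W W' -> (i <= i' <= k)%N ->
  \sum_(i.+1 <= b < i'.+1) placed_int k.+1 [::] [::] W' b t =
  placed_int k [::] [::] W i t - placed_int k [::] [::] W i' t.
Proof.
move=> dW /andP[]; elim: i' => [|i' IH].
  by rewrite leqn0 => /eqP-> _; rewrite big_geq// subrr.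
rewrite leq_eqVlt => /orP[/eqP <- _|]; first by rewrite big_geq// subrr.
rewrite ltnS => ii' ik; rewrite sum_nat_recr// IH ?(ltnW ik)//.
by rewrite (placed_int_parts _ _ _ dW)// placed_int_skip// addrA subrK.
Qed.

Lemma placed_int_nil k (W : curve R n 1) t : placed_int k [::] [::] W k t = vol k t *: W 0.
Proof. by rewrite /placed_int subnn place_nil iter_int_one. Qed.

Lemma iter_int_placed k js As A (v : 'cV[R]_n) j t : (j <= k)%N ->
  size As = size js -> all (fun a => a < j)%N js ->
  iter_int (place k.+1 (rcons js j) (rcons As A)) (ccst v) t =
  placed_int k.+1 js As (cmul A (ccst v)) j t.
Proof.
move=> jk sA jsj.
have -> : place k.+1 (rcons js j) (rcons As A) = place j js As ++ A :: nseq (k - j) cone.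
  have Ek : k.+1 = (j.+1 + (k - j))%N by rewrite addSn subnKC.
  rewrite /place Ek iotaD map_cat -/(place j.+1 _ _) place_rcons cat_rcons.
  rewrite place_rcons_rcons//; congr (_ ++ _ :: _).
    rewrite -(cats1 js) index_cat (negbTE (all_ltn_notin jsj)) /= eqxx addn0.
    by rewrite nth_rcons sA ltnn eqxx.
  apply: (@eq_from_nth _ cone); first by rewrite size_map size_iota size_nseq.
  move=> i; rewrite size_map size_iota => ik.
  rewrite (nth_map 0) ?size_iota// nth_iota// nth_nseq ik add0n.
  rewrite place_notin ?size_rcons ?sA// all_ltn_notin// all_rcons ltn_addr//=.
  by apply/allP => a /(allP jsj) aj; rewrite ltn_addr// ltnW.
rewrite iter_int_cat /placed_int subSn//; apply: iter_int_ext => s /=.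
by apply: mprim_ext => v' /=; rewrite iter_int_one scalemxAr.
Qed.

End Insertion.

(** * Carrying a field along the line through a chain of gradients *)

Section Expansion.
Variables (R : realType) (n : nat) (z1 h : 'cV[R]_n).
Local Notation field := (field R n).
Implicit Types (f g : field) (fs : seq field) (js : seq nat).

Definition line (t : R) : 'cV[R]_n := z1 + t *: h.

Lemma is_derive_along f a (x : R) :
  is_derive x 1 (fun t => f (line t) a 0) ((grad f (line x) *m h) a 0).
Proof.
have := @is_derive_line _ _ (fun y => f y a 0) z1 h x
  (diff_derivable (diff_comp_entry a (field_diff f _))).
by rewrite derive_entry ?grad_mul//; exact: field_diff.
Qed.

Lemma field_along_cont f a b : continuous (fun t => f (line t) a b).
Proof. rewrite (ord1 b); exact: is_derive_continuous (is_derive_along f a). Qed.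

Definition fieldc f : curve R n 1 := Curve (@field_along_cont f).

Lemma grad_along_cont f a b : continuous (fun t => grad f (line t) a b).
Proof.
rewrite (_ : (fun t => _) = (fun t => fpartial b f (line t) a 0)).
  exact: (is_derive_continuous (is_derive_along (fpartial b f) a)).
by apply/funext => t; rewrite gradE ?mxE//; exact: field_diff.
Qed.

Definition gradc f : curve R n n := Curve (@grad_along_cont f).

Definition dfieldc f : curve R n 1 := cmul (gradc f) (ccst h).

Lemma mderive_fieldc f : mderive (fieldc f) (dfieldc f).
Proof. by move=> a b x; rewrite (ord1 b); exact: is_derive_along. Qed.

Lemma placed_int_ext k js (As : seq (curve R n n)) (W W' : curve R n 1) j t : W =1 W' ->
  placed_int k js As W j t = placed_int k js As W' j t.
Proof.
move=> WW'; apply: iter_int_ext => s; case: (k - j)%N => [|m] /=; first by rewrite WW'.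
by apply: mprim_ext => v /=; rewrite WW'.
Qed.

Lemma cmul_gradc f g : cmul (gradc f) (fieldc g) =1 fieldc (fgraft g f).
Proof. by move=> t /=; rewrite -fgraft_grad. Qed.

Definition nested fs g := foldr (fun f acc => fgraft acc f) g fs.

Lemma nested_rcons fs f g : nested (rcons fs f) g = nested fs (fgraft g f).
Proof. exact: foldr_rcons. Qed.

(** Induction on the chain from its last gradient, since [g] meets that one first. The subtracted
    sum number l collects the moves between occupied slots l and l + 1, where the fields from rank l
    + 1 on are already nested in the vector. *)
Lemma placed_int_expand k (is_ : seq nat) fs g i' t :
  (0 < size fs)%N -> size fs = size is_ -> sorted ltn (rcons is_ i') -> (i' <= k)%N ->
  placed_int k is_ (map gradc fs) (fieldc g) i' t =
  vol k t *: nested fs g z1 +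
  \sum_((head 0 is_).+1 <= b < k.+1) placed_int k.+1 [::] [::] (dfieldc (nested fs g)) b t -
  \sum_(1 <= l < (size fs).+1) \sum_((nth 0 is_ l.-1).+1 <= b < (nth i' is_ l).+1)
    placed_int k.+1 (take l is_) (map gradc (take l fs)) (dfieldc (nested (drop l fs) g)) b t.
Proof.
elim/last_ind: fs is_ g i' => [//|fs f IH] is_ g i' _.
case/lastP: is_ => [|is_ i]; first by rewrite size_rcons.
rewrite !size_rcons => -[sfi] srt i'k.
move/sorted_rcons_ltn: (srt) => /andP[srt']; rewrite all_rcons => /andP[ii' isi'].
move/sorted_rcons_ltn: (srt') => /andP[_ isi].
have sA : size (map gradc fs) = size is_ by rewrite size_map.
(* Carry [g] from [i'] back to the last occupied slot [i], where it becomes [fgraft g f]. *)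
have := sum_placed_int (gradc f) t (mderive_fieldc g) sA isi (_ : i < i' <= k)%N.
rewrite ii' i'k => /(_ isT) /eqP; rewrite eq_sym subr_eq addrC -subr_eq => /eqP E.
rewrite map_rcons -E {E} (placed_int_ext _ _ _ _ _ (cmul_gradc f g)).
rewrite [X in _ = _ - X]sum_nat_recr//.
rewrite opprD addrA; congr (_ - _); last first.
  have -> : nth 0 (rcons is_ i) (size fs).+1.-1 = i by rewrite /= nth_rcons sfi ltnn eqxx.
  rewrite sfi nth_default ?size_rcons//.
  by rewrite !take_oversize ?drop_oversize ?size_rcons ?sfi// map_rcons.
case: (posnP (size fs)) => [fs0|fs0].
  move/size0nil: (fs0) sfi => -> /esym/size0nil -> /=.
  (* No gradient is left: descend from slot [i] to position [k], that is, to time 0. *)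
  have := sum_placed_int0 t (mderive_fieldc (fgraft g f)) (_ : i <= k <= k)%N.
  rewrite (ltnW (leq_trans ii' i'k)) leqnn => /(_ isT) ->.
  rewrite placed_int_nil /= /line scale0r addr0 big_geq// subr0.
  by rewrite addrC subrK.
rewrite (IH is_)//; last exact: ltnW (leq_trans ii' i'k).
rewrite nested_rcons.
congr (_ + _ - _).
  by case: is_ sfi fs0 {isi sA srt isi' srt' IH} => [->|].
rewrite !big_nat; apply: eq_bigr => l /andP[l0 lfs].
have ls : (l <= size is_)%N by rewrite -sfi.
rewrite -!cats1 !takel_cat ?sfi// !cats1 drop_rcons ?sfi// nested_rcons.
have -> : nth 0 (rcons is_ i) l.-1 = nth 0 is_ l.-1.
  by rewrite nth_rcons ifT// prednK.
congr (\sum_(_ <= b < (_).+1) _).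
rewrite nth_rcons; case: ltngtP ls => // [lt_l _|->]; last by rewrite nth_default.
exact: set_nth_default.
Qed.

End Expansion.

Lemma sorted_take_ltn l b s : sorted ltn s -> (0 < l <= size s)%N ->
  (nth 0 s l.-1 < b)%N -> all (fun a => a < b)%N (take l s).
Proof.
move=> ss /andP[l0 ls]; have := take_sorted l ss.
rewrite -(nth_take 0 (_ : l.-1 < l)%N) ?prednK//.
have : size (take l s) = l by rewrite size_takel.
case: (take l s) => [/esym l0'|x s' sl]; first by rewrite l0' in l0.
by rewrite -sl /= nth_last /=; exact: path_ltn_all.
Qed.

(** * The recursion for the integral attached to one tree *)

Section TreeRecursion.
Variables (R : realType) (n : nat) (z1 h : 'cV[R]_n) (F : nat -> field R n).
Implicit Types (r : btree).
Local Notation gradc := (gradc z1 h).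

Definition cut_fields r l := [seq bfield F q | q <- cut r l].

Definition tree_word_int q (A : 'M[R]_(n, q)) N r l j t : 'M[R]_(n, q) :=
  iter_int (place N j [seq gradc f | f <- cut_fields r l]) (ccst A) t.

Definition tree_int N r t : 'M[R]_n :=
  \sum_(1 <= l < (mL r).+2) (-1) ^+ (1 < l)%N *:
    \sum_(j <- words N l | sorted ltn j) (J r j)%:R *: tree_word_int 1%:M N r l j t.

(** The multiplicity with which the boundary value at [z1] appears: one for each index word of
    V^-(r), weighted by J. *)
Definition tree_weight r : R :=
  (\sum_(i <- words (size (bleaves r)).-1 (mL r) | sorted ltn i) J (Vminus r) i)%N%:R.

Lemma nested_bfield s a : nested [seq bfield F q | q <- s] (F a) = bfield F (comb (BLeaf a) s).
Proof. by elim: s => //= q s ->. Qed.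

Lemma cut_extend a r M l : (0 < M <= (mL r).+1)%N -> (l <= M)%N ->
  cut_fields (extend a r M) l.+1 = rcons (take l (cut_fields r M))
    (nested (drop l (cut_fields r M)) (F a)).
Proof.
move=> rM lM; rewrite /cut_fields {1}/cut map_rcons /Psub spine_extend.
by rewrite left_leaf_comb -nested_bfield -!map_take -!map_drop.
Qed.

Lemma sum_nat_insertable (W : nmodType) K i l (G : nat -> W) m p : (p <= K.+1)%N ->
  (forall b, (b < K.+1)%N -> insertable K i l b = (m <= b < p)%N) ->
  \sum_(m <= b < p) G b = \sum_(0 <= b < K.+1 | insertable K i l b) G b.
Proof.
move=> pK E; rewrite [RHS]big_nat_cond (big_nat_widenl m 0)// (big_nat_widen _ _ _ _ _ pK).
rewrite big_nat_cond; apply: eq_bigl => b.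
by case: ltnP => bK //=; rewrite ?andbF// E// andbC.
Qed.

(** At position [K] the field is evaluated at time 0, so the left side carries the constant
    [F a z1]. The vector that has absorbed the fields from rank l on is the last entry of the l-th
    cut of the extended tree. *)
Lemma placed_int_tree a r M i t : (0 < M <= (mL r).+1)%N ->
  let K := size (bleaves r) in i \in words K M -> sorted ltn i ->
  placed_int K i [seq gradc f | f <- cut_fields r M] (fieldc z1 h (F a)) K t =
  vol K t *: bfield F (extend a r M) z1 +
  \sum_(1 <= l < M.+2) (-1) ^+ (1 < l)%N *:
    \sum_(0 <= b < K.+1 | insertable K i l b)
      tree_word_int h K.+1 (extend a r M) l (rcons (take l.-1 i) b) t.
Proof.
move=> rM K; rewrite mem_words => /andP[/eqP iM iK] si.
have fM : size (cut_fields r M) = M by rewrite size_map size_cut.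
have M0 : (0 < M)%N by case/andP: rM.
have srt : sorted ltn (rcons i K).
  case: i {iM} si iK => //= x i; rewrite rcons_path => -> /=.
  by move=> /andP[xK /allP iK]; have := mem_last x i; rewrite inE => /orP[/eqP->|/iK].
rewrite placed_int_expand ?fM//.
rewrite nested_bfield -/(extend a r M) -addrA; congr (_ + _).
rewrite [RHS]big_ltn// expr0 scale1r; congr (_ + _).
  rewrite (@sum_nat_insertable _ K i 1)// [LHS]big_nat_cond [RHS]big_nat_cond.
  apply: eq_bigr => b /andP[/andP[_ bK] _].
  rewrite take0 /tree_word_int cut_extend// take0 drop0.
  by rewrite nested_bfield -(@iter_int_placed _ _ K [::] [::]).
rewrite -sumrN [RHS]big_add1 [LHS]big_nat [RHS]big_nat; apply: eq_bigr => l /andP[l0 lM].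
rewrite ltnS in lM; rewrite ltnS l0 expr1 scaleN1r; congr (- _).
have il : (take l i) = take l.+1.-1 i by [].
rewrite (@sum_nat_insertable _ K i l.+1)//; first last.
- move=> b bK; rewrite /insertable /=; case: l l0 lM {il} => //.
- rewrite ltnS; case: (ltnP l (size i)) => [li|il']; last by rewrite nth_default.
  exact/ltnW/(allP iK)/mem_nth.
rewrite [LHS]big_nat_cond [RHS]big_nat_cond.
apply: eq_bigr => b /andP[/andP[_ bK] ins].
rewrite /tree_word_int cut_extend// -(@iter_int_placed _ _ K).
- by rewrite map_rcons.
- by [].
- by rewrite size_map !size_take fM iM.
- apply: sorted_take_ltn => //; first by rewrite l0 iM.
  by case/andP: ins; case: (l) l0.
Qed.

(** The M-th cut of [r] gives the M-th extension, and [sum_J] gathers the new positions into the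
    function J of that extension. *)
Lemma tree_int_rec a r t : let K := size (bleaves r) in
  tree_int K r t *m F a z1 =
  \sum_(1 <= M < (mL r).+2) (-1) ^+ (1 < M)%N *:
    (tree_int K.+1 (extend a r M) t *m h +
     (tree_weight (extend a r M) * vol K t) *: bfield F (extend a r M) z1).
Proof.
move=> K; rewrite /tree_int mulmx_suml !big_nat; apply: eq_bigr => M.
rewrite ltnS => rM; rewrite -scalemxAl; congr (_ *: _).
rewrite mulmx_suml mL_extend//.
transitivity (\sum_(i <- words K M | sorted ltn i) (J r i)%:R *:
  (vol K t *: bfield F (extend a r M) z1 +
  \sum_(1 <= l < M.+2) (-1) ^+ (1 < l)%N *:
    \sum_(0 <= b < K.+1 | insertable K i l b)
      tree_word_int h K.+1 (extend a r M) l (rcons (take l.-1 i) b) t)).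
  rewrite big_seq_cond [RHS]big_seq_cond; apply: eq_bigr => i /andP[iK si].
  rewrite -(placed_int_tree _ _ rM)// -scalemxAl; congr (_ *: _).
  rewrite /placed_int subnn /tree_word_int; apply/esym; apply: iter_int_mulr => s.
  by rewrite /= /line scale0r addr0 mul1mx.
under eq_bigr do rewrite scalerDr.
rewrite big_split [LHS]addrC; congr (_ + _); last first.
  rewrite /tree_weight bleaves_extend Vminus_extend// mL_extend// natr_sum mulr_suml scaler_suml.
  by apply: eq_bigr => i _; rewrite scalerA.
have r0 : (0 < mL (extend a r M))%N by rewrite mL_extend//; case/andP: rM.
under eq_bigr do rewrite scaler_sumr.
rewrite exchange_big mulmx_suml !big_nat; apply: eq_bigr => l lM.
rewrite -scalemxAl mulmx_suml.
under eq_bigr do rewrite scalerA mulrC -scalerA.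
rewrite -scaler_sumr; congr (_ *: _).
transitivity (\sum_(j <- words K.+1 l | sorted ltn j) (J (extend a r M) j)%:R *:
   tree_word_int h K.+1 (extend a r M) l j t).
  have := @sum_J R _ (extend a r M) l (fun j => tree_word_int h K.+1 (extend a r M) l j t) r0.
  by rewrite mL_extend// bleaves_extend Vminus_extend// => ->.
apply: eq_bigr => j _; rewrite -scalemxAl; congr (_ *: _).
by apply: iter_int_mulr => s; rewrite /= mul1mx.
Qed.

End TreeRecursion.

(** * Summation over all trees with given leaves *)

Section SumOverTrees.
Variables (R : realType) (n : nat) (z1 h : 'cV[R]_n) (F : nat -> field R n).
Implicit Types (r : btree) (ls : seq nat).

Definition tree_sign r : R := (-1) ^+ ((size (bleaves r)).-1 - mR r).

Definition forest_int ls t : 'M[R]_n :=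
  \sum_(r <- trees_with_leaves ls) tree_sign r *: tree_int z1 h F (size ls).+1 r t.

Definition forest_coef ls : 'cV[R]_n :=
  \sum_(r <- trees_with_leaves ls) (tree_sign r * tree_weight R r) *: bfield F r z1.

Lemma tree_sign_extend a r M : (0 < M <= (mL r).+1)%N ->
  tree_sign (extend a r M) = tree_sign r * (-1) ^+ (1 < M)%N.
Proof.
move=> rM; rewrite /tree_sign bleaves_extend mR_extend//= -exprD.
have := mR_lt r; case: (size (bleaves r)) => [//|k] /=; rewrite ltnS => rk.
case: M rM => [//|[|M]] _ /=; first by rewrite subSS addn0.
by rewrite subSn// addn1.
Qed.

Lemma sum_trees_cons (W : nmodType) a ls (G : btree -> W) :
  \sum_(r <- trees_with_leaves (a :: ls)) G r =
  \sum_(r <- trees_with_leaves ls) \sum_(1 <= M < (mL r).+2) G (extend a r M).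
Proof. by rewrite big_allpairs_dep. Qed.

(** The sign of the M-th cut is the ratio of the signs of [extend a r M] and [r], so trees with a
    chosen cut sum up to signed trees with one more leaf. *)
Lemma forest_int_rec a ls t :
  forest_int ls t *m F a z1 =
  forest_int (a :: ls) t *m h + vol (size ls).+1 t *: forest_coef (a :: ls).
Proof.
rewrite /forest_int /forest_coef !sum_trees_cons !mulmx_suml scaler_sumr -big_split.
rewrite [LHS]big_seq [RHS]big_seq; apply: eq_bigr => r.
rewrite mem_trees_with_leaves => /eqP Er.
have sr : size (bleaves r) = (size ls).+1 by rewrite Er size_rcons.
rewrite -scalemxAl -sr tree_int_rec scaler_sumr mulmx_suml scaler_sumr -big_split.
rewrite [LHS]big_nat [RHS]big_nat; apply: eq_bigr => M; rewrite ltnS => rM.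
rewrite [LHS]scalerA -(tree_sign_extend a rM) scalerDr sr -scalemxAl; congr (_ + _).
by rewrite !scalerA; congr (_ *: _); rewrite mulrA mulrC.
Qed.

Lemma forest_int0 t : forest_int [::] t *m h = F 0 (line z1 h t) - F 0 z1.
Proof.
rewrite /forest_int big_seq1 /tree_sign /= expr0 scale1r /tree_int /= big_nat1.
rewrite expr0 scale1r big_mkcond big_seq1 /= /J /= scale1r.
rewrite /tree_word_int /cut_fields cut1 /=.
rewrite -(@mprim_mulr _ _ _ _ _ (dfieldc z1 h (F 0)) h); last first.
  by move=> s; rewrite /= mulmx1.
rewrite -(@mprim_unique _ _ _ (fun t => F 0 (line z1 h t) - F 0 z1))//.
  move=> a b x; apply: (is_derive_ext (is_deriveB (mderive_fieldc z1 h (F 0) a b x)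
    (is_derive_cst (F 0 z1 a b) x 1))); last by rewrite subr0.
  by move=> y; rewrite mxE [X in _ = _ + X]mxE.
by rewrite /line scale0r addr0 subrr.
Qed.

End SumOverTrees.

(** * Growth of iterated integrals near time 0 *)

Section Bounds.
Variable R : realType.

Lemma continuous_bound (f : R -> R) : continuous f ->
  exists2 C, 0 <= C & forall t, 0 <= t <= 1 -> `|f t| <= C.
Proof.
move=> cf; have cf' : {within `[0, 1], continuous (fun t => `|f t|)}.
  apply: continuous_subspaceT => x; apply: continuous_comp; first exact: cf.
  exact: norm_continuous.
have [c c01 fc] := EVT_max ler01 cf'.
by exists `|f c| => // t t01; apply: fc; rewrite in_itv.
Qed.

Lemma curve_bound p q (W : curve R p q) :
  exists2 C, 0 <= C & forall t, 0 <= t <= 1 -> forall a b, `|W t a b| <= C.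
Proof.
pose C a b := sval (cid2 (continuous_bound (@ccont _ _ _ W a b))).
have CP a b : 0 <= C a b /\ forall t, 0 <= t <= 1 -> `|W t a b| <= C a b.
  by rewrite /C; case: cid2.
exists (\sum_a \sum_b C a b).
  by apply: sumr_ge0 => a _; apply: sumr_ge0 => b _; case: (CP a b).
move=> t t01 a b; apply: le_trans ((CP a b).2 t t01) _.
rewrite (bigD1 a)//= (bigD1 b)//= -addrA lerDl addr_ge0//.
  by apply: sumr_ge0 => b' _; case: (CP a b').
by apply: sumr_ge0 => a' _; apply: sumr_ge0 => b' _; case: (CP a' b').
Qed.

Lemma mprim_bound p q (W : curve R p q) (t M : R) a b : 0 <= t ->
  (forall s, 0 <= s <= t -> `|W s a b| <= M) -> `|mprim W t a b| <= M * t.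
Proof.
move=> t0 WM.
have [|c c_in] := MVT_segment t0 (fun x _ => mprimP W a b x).
  exact/continuous_subspaceT/ccont.
rewrite mprim0 mxE !subr0 => ->; rewrite normrM (ger0_norm t0) ler_wpM2r// WM//.
Qed.

(** Each integration from 0 gains one factor [t], by the mean value theorem. *)
Lemma iter_int_bound n q (Bs : seq (curve R n n)) (W : curve R n q) :
  exists2 C, 0 <= C & forall t, 0 <= t <= 1 -> forall a b,
    `|iter_int Bs W t a b| <= C * t ^+ size Bs.
Proof.
elim: Bs => [|B Bs [C C0 HC]].
  have [C C0 HC] := curve_bound W; exists C => // t t01 a b.
  by rewrite expr0 mulr1; exact: HC.
have [D D0 HD] := curve_bound B.
exists (n%:R * (D * C)); first by rewrite !mulr_ge0.
move=> t /andP[t0 t1] a b.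
rewrite /= exprSr mulrA; apply: mprim_bound => // s /andP[s0 st].
have s01 : 0 <= s <= 1 by rewrite s0 (le_trans st).
rewrite mxE (le_trans (ler_norm_sum _ _ _))//.
apply: (@le_trans _ _ (\sum_(i < n) D * C * t ^+ size Bs)).
  apply: ler_sum => i _; rewrite normrM -mulrA ler_pM//; first exact: HD.
  apply: le_trans (HC _ s01 _ _) _; rewrite ler_wpM2l//.
  by rewrite lerXn2r// nnegrE.
by rewrite sumr_const card_ord -!mulrA mulr_natl.
Qed.

End Bounds.

(** * Independence of the names of the leaves *)

Section Relabel.
Implicit Types (r : btree).

(** [J], [mL] and [mR] see only the shape of a tree, so the integral attached to a word of fields
    does not depend on the letters naming them. *)
Fixpoint relabel (phi : nat -> nat) r : btree :=
  match r with
  | BLeaf a => BLeaf (phi a)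
  | BNode r1 r2 => BNode (relabel phi r1) (relabel phi r2)
  end.

Variable phi : nat -> nat.

Lemma spine_relabel r : spine (relabel phi r) = map (relabel phi) (spine r).
Proof. by elim: r => //= r1 -> r2. Qed.

Lemma left_leaf_relabel r : left_leaf (relabel phi r) = phi (left_leaf r).
Proof. by elim: r. Qed.

Lemma mL_relabel r : mL (relabel phi r) = mL r.
Proof. by rewrite /mL spine_relabel size_map. Qed.

Lemma mR_relabel r : mR (relabel phi r) = mR r.
Proof. by elim: r => //= r1 _ r2 ->. Qed.

Lemma bleaves_relabel r : bleaves (relabel phi r) = map phi (bleaves r).
Proof. by elim: r => //= r1 -> r2 ->; rewrite map_cat. Qed.

Lemma comb_relabel x s : relabel phi (comb x s) = comb (relabel phi x) (map (relabel phi) s).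
Proof. by elim: s => //= q s ->. Qed.

Lemma cut_relabel r l : cut (relabel phi r) l = map (relabel phi) (cut r l).
Proof.
rewrite /cut /Psub map_rcons comb_relabel /= spine_relabel left_leaf_relabel.
by rewrite map_take map_drop.
Qed.

Lemma Vminus_relabel r : Vminus (relabel phi r) = relabel phi (Vminus r).
Proof.
rewrite /Vminus comb_relabel spine_relabel mL_relabel map_take.
by rewrite last_map.
Qed.

Lemma J_relabel r j : J (relabel phi r) j = J r j.
Proof.
rewrite /J bleaves_relabel size_map.
move: (size (bleaves r)).-1 => k; elim: k r j => [//|k IH] r j /=; rewrite mL_relabel Vminus_relabel.
case: ifP => _; first by apply: eq_bigr => i _; rewrite IH.
by case: ifP => _; [apply: eq_bigr => i _|]; rewrite IH.
Qed.

Lemma trees_relabel ls : phi 0 = 0 ->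
  trees_with_leaves (map phi ls) = map (relabel phi) (trees_with_leaves ls).
Proof.
move=> phi0; elim: ls => [|a ls IH]; first by rewrite /= phi0.
have twl b s : trees_with_leaves (b :: s) =
  [seq extend b r l | r <- trees_with_leaves s, l <- index_iota 1 (mL r).+2] by [].
rewrite [map _ (a :: ls)]/= !twl {twl} IH map_allpairs allpairs_mapl.
under eq_allpairsr do rewrite mL_relabel.
by apply: eq_allpairs => r l; rewrite /extend comb_relabel cut_relabel.
Qed.

End Relabel.

(** * Integrals and coefficients attached to words of fields *)

Section WordForm.
Variables (R : realType) (n : nat) (z1 h : 'cV[R]_n).
Local Notation field := (field R n).
Implicit Types (ls : seq nat) (F : nat -> field) (fs : seq field) (g f : field) (r : btree).

Lemma bfield_relabel F phi r : bfield F (relabel phi r) = bfield (F \o phi) r.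
Proof. by elim: r => //= r1 -> r2 ->. Qed.

Lemma tree_word_int_relabel F phi q (A : 'M[R]_(n, q)) N r l j t :
  tree_word_int z1 h F A N (relabel phi r) l j t =
  tree_word_int z1 h (F \o phi) A N r l j t.
Proof.
congr (iter_int (place _ _ (map _ _)) _ _); rewrite /cut_fields cut_relabel -map_comp.
by apply: eq_map => x /=; rewrite bfield_relabel.
Qed.

Lemma tree_int_relabel F phi N r t :
  tree_int z1 h F N (relabel phi r) t = tree_int z1 h (F \o phi) N r t.
Proof.
rewrite /tree_int mL_relabel; apply: eq_bigr => l _; congr (_ *: _).
by apply: eq_bigr => j _; rewrite J_relabel tree_word_int_relabel.
Qed.

Lemma tree_sign_relabel phi r : tree_sign R (relabel phi r) = tree_sign R r.
Proof. by rewrite /tree_sign bleaves_relabel size_map mR_relabel. Qed.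

Lemma eq_bfield F F' r : {in bleaves r, F =1 F'} -> bfield F r = bfield F' r.
Proof.
elim: r => [a|r1 IH1 r2 IH2] /= FF'; first by rewrite FF' ?mem_head.
by rewrite IH1 ?IH2// => a ar; apply: FF'; rewrite mem_cat ar ?orbT.
Qed.

Lemma sub_bleaves_cut r l q : q \in cut r l -> {subset bleaves q <= bleaves r}.
Proof.
move=> qr a aq; rewrite -(comb_Psub r l) bleaves_comb mem_cat; move: qr.
rewrite /cut mem_rcons inE => /orP[/eqP <-|qr]; first by rewrite aq.
by apply/orP; right; apply/flatten_mapP; exists q; rewrite ?mem_rev.
Qed.

Lemma eq_tree_int F F' N r t : {in bleaves r, F =1 F'} ->
  tree_int z1 h F N r t = tree_int z1 h F' N r t.
Proof.
move=> FF'; apply: eq_bigr => l _; congr (_ *: _); apply: eq_bigr => j _.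
rewrite /tree_word_int /cut_fields; congr (_ *: iter_int (place _ _ (map _ _)) _ _).
apply/eq_in_map => q qr; apply: eq_bfield => a aq; apply: FF'.
exact: sub_bleaves_cut qr _ aq.
Qed.

(** Canonical labels: 0 for [g], j for the j-th field of [fs]. They are reversed because leaves are
    listed from left to right, whereas the word is read from right to left. *)
Definition word_int g fs t : 'M[R]_n :=
  forest_int z1 h (nth g (g :: fs)) (rev (iota 1 (size fs))) t.

Definition word_coef g fs : 'cV[R]_n :=
  forest_coef z1 (nth g (g :: fs)) (rev (iota 1 (size fs))).

Definition relab (ls : seq nat) : nat -> nat := nth 0 (0%N :: rev ls).

Lemma map_relab ls : map (relab ls) (rev (iota 1 (size ls))) = ls.
Proof.
rewrite map_rev /relab map_nth_iota; last by rewrite /= subn1 size_rev.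
by rewrite /= drop0 -size_rev take_size revK.
Qed.

Lemma relab_field F ls r : bleaves r = rcons (rev (iota 1 (size ls))) 0 ->
  {in bleaves r, F \o relab ls =1 nth (F 0) (F 0 :: map F (rev ls))}.
Proof.
move=> -> a; rewrite mem_rcons inE mem_rev mem_iota => al.
have {}al : (a < (size ls).+1)%N by case/orP: al => [/eqP->|/andP[]].
by rewrite /= /relab -[F 0 :: _]/(map F (0 :: rev ls)) (nth_map 0)//= size_rev.
Qed.

Lemma forest_int_word F ls t : forest_int z1 h F ls t = word_int (F 0) (map F (rev ls)) t.
Proof.
rewrite /forest_int -{1}(map_relab ls) trees_relabel// big_map.
rewrite /word_int /forest_int size_map size_rev size_rev size_iota.
rewrite [LHS]big_seq [RHS]big_seq; apply: eq_bigr => r.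
rewrite mem_trees_with_leaves => /eqP Er.
rewrite tree_sign_relabel tree_int_relabel; congr (_ *: _).
exact/eq_tree_int/relab_field.
Qed.

Lemma word_int_rec g fs f t :
  word_int g fs t *m f z1 =
  word_int g (rcons fs f) t *m h + vol (size fs).+1 t *: word_coef g (rcons fs f).
Proof.
set F := nth g (g :: rcons fs f); set k := size fs.
have Ff : F k.+1 = f by rewrite /F /= nth_rcons ltnn eqxx.
have Ffs : map F (iota 1 k) = fs.
  rewrite /F map_nth_iota; last by rewrite /= subn1 size_rcons.
  by rewrite /= drop0 -cats1 take_size_cat.
have Ek : k.+1 :: rev (iota 1 k) = rev (iota 1 k.+1).
  by rewrite -[k.+1 in RHS]addn1 iotaD /= cats1 rev_rcons add1n.
have := forest_int_rec z1 h F k.+1 (rev (iota 1 k)) t.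
by rewrite Ff forest_int_word revK Ffs Ek size_rev size_iota /word_int /word_coef size_rcons.
Qed.

Lemma word_int0 g t : word_int g [::] t *m h = g (line z1 h t) - g z1.
Proof. exact: forest_int0. Qed.

Lemma fgraft_fsumr (I : Type) (s : seq I) f (G : I -> field) :
  fgraft f (fsum s G) = fsum s (fun i => fgraft f (G i)).
Proof. by apply: field_ext => z; rewrite fgraft_sumr. Qed.

Lemma fgraft_fsuml (I : Type) (s : seq I) f (G : I -> field) :
  fgraft (fsum s G) f = fsum s (fun i => fgraft (G i) f).
Proof. by apply: field_ext => z; rewrite fgraft_suml. Qed.

(** [F x] is a family of fields with [x] in place [j]. A label that occurs on exactly one leaf makes
    the iterated pre-Lie product additive in its field. *)
Lemma bfield_sum (I : Type) (s : seq I) (G : I -> field) (F : field -> nat -> field) j r :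
  (forall x, F x j = x) -> (forall x y a, a != j -> F x a = F y a) ->
  count_mem j (bleaves r) = 1%N ->
  bfield (F (fsum s G)) r = fsum s (fun i => bfield (F (G i)) r).
Proof.
move=> Fj FC; elim: r => [a|r1 IH1 r2 IH2] /=.
  rewrite addn0; case: (a =P j) => [-> _|//].
  by rewrite Fj; apply: field_ext => z /=; apply: eq_bigr => i _; rewrite Fj.
have const r x y : count_mem j (bleaves r) = 0%N -> bfield (F x) r = bfield (F y) r.
  move=> c0; apply: eq_bfield => a ar; apply: FC; apply: contraTneq ar => ->.
  by rewrite -has_pred1 has_count c0.
rewrite count_cat; case E1 : (count_mem j (bleaves r1)) => [|c1].
  rewrite add0n => E2; rewrite IH2// fgraft_fsumr; apply: field_ext => z.
  by apply: eq_bigr => i _; rewrite (const r1 (fsum s G) (G i)).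
rewrite addSn => -[] /eqP; rewrite addn_eq0 => /andP[/eqP c10 /eqP E2].
rewrite IH1 ?E1 ?c10// fgraft_fsuml; apply: field_ext => z.
by apply: eq_bigr => i _; rewrite (const r2 (fsum s G) (G i)).
Qed.

Lemma word_coef_sum (I : Type) (s : seq I) (G : I -> field) g s1 s2 :
  word_coef g (s1 ++ fsum s G :: s2) = \sum_(i <- s) word_coef g (s1 ++ G i :: s2).
Proof.
pose k := size (s1 ++ g :: s2).
have sk x : size (s1 ++ x :: s2) = k by rewrite /k !size_cat.
rewrite /word_coef sk; under [RHS]eq_bigr do rewrite sk.
rewrite exchange_big [LHS]big_seq [RHS]big_seq; apply: eq_bigr => r.
rewrite mem_trees_with_leaves => /eqP Er; rewrite -scaler_sumr; congr (_ *: _).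
rewrite (@bfield_sum _ s G (fun x => nth g (g :: s1 ++ x :: s2)) (size s1).+1)//.
- by move=> x; rewrite /= nth_cat ltnn subnn.
- move=> x y [//|a]; rewrite eqSS /= !nth_cat => /negbTE aj; case: ltnP => // ja.
  by case E : (a - size s1)%N => //=; move: E ja aj; lia.
rewrite Er -cats1 count_cat count_rev /= addn0 count_uniq_mem ?iota_uniq// mem_iota.
by rewrite /= /k size_cat /= addnS ltnS ltnS leq_addr.
Qed.

End WordForm.

(** * Comparison of powers of t at 0 *)

Section OrderOfVanishing.
Variable R : realType.

Definition vanishing N p q (W : R -> 'M[R]_(p, q)) :=
  exists2 C, 0 <= C & forall t, 0 <= t <= 1 -> forall a b, `|W t a b| <= C * t ^+ N.

Lemma vanishingD N p q (W W' : R -> 'M[R]_(p, q)) : vanishing N W -> vanishing N W' ->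
  vanishing N (fun t => W t + W' t).
Proof.
move=> [C C0 WC] [D D0 WD]; exists (C + D) => [|t t01 a b]; first exact: addr_ge0.
by rewrite mxE mulrDl (le_trans (ler_normD _ _))// lerD// ?WC ?WD.
Qed.

Lemma vanishingZ N p q c (W : R -> 'M[R]_(p, q)) : vanishing N W ->
  vanishing N (fun t => c *: W t).
Proof.
move=> [C C0 WC]; exists (`|c| * C) => [|t t01 a b]; first exact: mulr_ge0.
by rewrite mxE normrM -mulrA ler_wpM2l// WC.
Qed.

Lemma vanishing_sum N p q I (s : seq I) (P : pred I) (W : I -> R -> 'M[R]_(p, q)) :
  (forall i, vanishing N (W i)) -> vanishing N (fun t => \sum_(i <- s | P i) W i t).
Proof.
move=> WN; elim: s => [|i s IH].
  by exists 0 => // t t01 a b; rewrite big_nil mxE normr0 mul0r.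
have [C C0 HC] := vanishingD (WN i) IH; have [D D0 HD] := IH.
case Pi : (P i); [exists C|exists D] => // t t01 a b; rewrite big_cons Pi; first exact: HC.
exact: HD.
Qed.

Lemma vanishing_mulr N p q r (A : 'M[R]_(q, r)) (W : R -> 'M[R]_(p, q)) :
  vanishing N W -> vanishing N (fun t => W t *m A).
Proof.
move=> [C C0 WC]; exists (\sum_j \sum_b C * `|A j b|) => [|t t01 a b].
  by apply: sumr_ge0 => j _; apply: sumr_ge0 => b _; exact: mulr_ge0.
have t0 : 0 <= t ^+ N by rewrite exprn_ge0//; case/andP: t01.
rewrite mxE (le_trans (ler_norm_sum _ _ _))// mulr_suml; apply: ler_sum => j _.
rewrite (bigD1 b)//= mulrDl normrM -[leLHS]addr0 lerD//.
  by rewrite mulrAC ler_wpM2r// WC.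
by rewrite mulr_ge0// sumr_ge0// => b' _; exact: mulr_ge0.
Qed.

Lemma vanishing_iter_int n q (Bs : seq (curve R n n)) (W : curve R n q) :
  vanishing (size Bs) (iter_int Bs W).
Proof. exact: iter_int_bound. Qed.

Lemma vanishing_vol k p q (A : 'M[R]_(p, q)) :
  vanishing k.+1 (fun t => vol k t *: A) -> A = 0.
Proof.
move=> [C C0 HC]; apply/matrixP => a b; rewrite mxE; apply/eqP/negPn/negP => Aab.
pose c := `|A a b|; have c0 : 0 < c by rewrite normr_gt0.
pose D := C * k`!%:R + 1; have D0 : 0 < D by rewrite ltr_wpDl// mulr_ge0.
(* Dividing the bound by [t ^+ k] gives c <= t C k!, which is false once t D < c. *)
pose t := Num.min 1 (c / (2 * D)).
have t0 : 0 < t by rewrite lt_min ltr01 divr_gt0// mulr_gt0.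
have t1 : t <= 1 by rewrite ge_min lexx.
have tc : t * D < c.
  have : t <= c / (2 * D) by rewrite ge_min lexx orbT.
  rewrite ler_pdivlMr ?mulr_gt0// => tc; have : t * D * 2 <= c by rewrite -mulrA (mulrC D).
  have := mulr_gt0 t0 D0; lra.
have := HC t _ a b; rewrite (ltW t0) t1 => /(_ isT).
rewrite mxE normrM /vol normrM normfV normr_nat (ger0_norm (exprn_ge0 k (ltW t0))) -/c.
rewrite mulrAC ler_pdivrMr ?ltr0n ?fact_gt0// exprS.
have T0 : 0 < t ^+ k by rewrite exprn_gt0.
rewrite (_ : C * (t * t ^+ k) * k`!%:R = t ^+ k * (t * (C * k`!%:R))); last by ring.
rewrite ler_pM2l// => cC; move: tc; rewrite /D mulrDr mulr1 => tc.
by have := lt_le_trans tc cC; rewrite gtrDl ltNge (ltW t0).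
Qed.

End OrderOfVanishing.

(** * The coefficient of a constant word as a Taylor coefficient *)

Section Diagonal.
Variables (R : realType) (n : nat) (z1 : 'cV[R]_n).
Local Notation field := (field R n).
Implicit Types (f g : field).

Lemma mder_values (fs fs' : seq field) g z :
  [seq fval f z | f <- fs] = [seq fval f z | f <- fs'] -> mder fs g z = mder fs' g z.
Proof.
elim: fs fs' g => [|f fs IH] [|f' fs'] g // [ff' fsfs']; rewrite !mder_cons.
by apply: eq_bigr => b _; rewrite ff' (IH fs').
Qed.

Definition cst_field (v : 'cV[R]_n) : field := Field (smooth_cst v).

(** A constant field has zero derivative, so of the Leibniz rule only the term that differentiates
    [g] survives. *)
Lemma fgraft_cst_mder v k g z :
  fgraft (cst_field v) (mder (nseq k (cst_field v)) g) z = mder (nseq k.+1 (cst_field v)) g z.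
Proof.
rewrite mder_leibniz [X in _ + X]big1 ?addr0// => i _.
have is_ : (i < size (nseq k (cst_field v)))%N by [].
have ik : (i < k)%N by rewrite -[X in (_ < X)%N](size_nseq k (cst_field v)).
rewrite set_nthE is_ (_ : fgraft _ _ = fsum [::] (fun _ : nat => cst_field v)).
  by rewrite mder_add big_nil.
apply: field_ext => y; rewrite /= big_nil nth_nseq ik.
by rewrite big1// => b _; rewrite derive_cst scaler0.
Qed.

Lemma taylor_step v k g t :
  iter_int (nseq k cone) (fieldc z1 v g) t = vol k t *: g z1 +
  iter_int (nseq k.+1 cone) (fieldc z1 v (fgraft (cst_field v) g)) t.
Proof.
rewrite -iter_int_one -[X in _ = _ + X]scale1r -[k.+1]addn1 nseqD iter_int_cat.
apply: iter_int_comb => s; rewrite scale1r /=.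
rewrite -(@mprim_unique _ _ _ (fun t => g (line z1 v t) - g z1)).
- by rewrite addrC subrK.
- move=> a b x; apply: (is_derive_ext (is_deriveB (mderive_fieldc z1 v g a b x)
    (is_derive_cst (g z1 a b) x 1))).
    by move=> y; rewrite mxE [X in _ = _ + X]mxE.
  transitivity ((1%:M *m fgraft (cst_field v) g (line z1 v x)) a b); last by [].
  by rewrite mul1mx fgraft_grad subr0.
- by rewrite /line scale0r addr0 subrr.
Qed.

Lemma taylor v k g t : g (line z1 v t) =
  \sum_(0 <= j < k) vol j t *: mder (nseq j (cst_field v)) g z1 +
  iter_int (nseq k cone) (fieldc z1 v (mder (nseq k (cst_field v)) g)) t.
Proof.
elim: k => [|k ->]; first by rewrite big_geq// add0r.
rewrite sum_nat_recr// -[RHS]addrA; congr (_ + _); rewrite taylor_step; congr (_ + _).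
by apply: iter_int_ext => s; exact: fgraft_cst_mder.
Qed.

Lemma nseqSr (T : Type) k (x : T) : nseq k.+1 x = rcons (nseq k x) x.
Proof. by rewrite -cats1 -[k.+1]addn1 nseqD. Qed.

Lemma word_expansion f g k t : g (line z1 (f z1) t) =
  g z1 + \sum_(1 <= j < k.+1) vol j t *: word_coef z1 g (nseq j f) +
  word_int z1 (f z1) g (nseq k f) t *m f z1.
Proof.
elim: k => [|k ->]; first by rewrite big_geq// word_int0 addr0 addrC subrK.
by rewrite [in RHS]sum_nat_recr// word_int_rec -nseqSr size_nseq -!addrA [_ *m _ + _]addrC.
Qed.

Lemma vanishing_word_int h g fs : vanishing (size fs).+1 (word_int z1 h g fs).
Proof.
apply: vanishing_sum => r; apply: vanishingZ; apply: vanishing_sum => l; apply: vanishingZ.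
apply: vanishing_sum => j; apply: vanishingZ.
have := @vanishing_iter_int R n n (place (size (rev (iota 1 (size fs)))).+1 j
   [seq gradc z1 h f | f <- cut_fields (nth g (g :: fs)) r l]) (ccst 1%:M).
by rewrite size_map size_iota size_rev size_iota.
Qed.

Lemma word_coef_diag f g k : (0 < k)%N ->
  word_coef z1 g (nseq k f) = mder (nseq k f) g z1.
Proof.
elim/ltn_ind: k => -[//|k] IH _; apply/eqP; rewrite -subr_eq0; apply/eqP.
set v := f z1.
(* The fields are not differentiated by [mder], so only their value at [z1] matters. *)
have mderE j : mder (nseq j f) g z1 = mder (nseq j (cst_field v)) g z1.
  by apply: mder_values; rewrite !map_nseq.
apply: (@vanishing_vol _ k.+1).
(* Both remainders are iterated integrals over [k.+2] times, one more than the degree of the terms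
   compared; the lower terms cancel by induction. *)
pose W1 t := iter_int (nseq k.+2 cone) (fieldc z1 v (mder (nseq k.+2 (cst_field v)) g)) t.
pose W2 t := word_int z1 v g (nseq k.+1 f) t *m v.
have E : (fun t => vol k.+1 t *: (word_coef z1 g (nseq k.+1 f) - mder (nseq k.+1 f) g z1)) =
    (fun t => W1 t + (-1) *: W2 t).
  apply/funext => t.
  have Ew := word_expansion f g k.+1 t.
  rewrite (taylor v k.+2) [in LHS]sum_nat_recr// [in LHS]big_ltn// in Ew.
  rewrite [in RHS]sum_nat_recr// vol0 scale1r -/(W1 t) -/(W2 t) -!mderE in Ew.
  move: Ew; rewrite [X in g z1 + X](_ : _ = \sum_(1 <= j < k.+1) vol j t *: word_coef z1 g (nseq j f)).
    rewrite -!addrA => /addrI /addrI E.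
    rewrite scalerBr scaleN1r; apply/eqP; rewrite subr_eq addrAC eq_sym subr_eq.
    by rewrite [W1 t + _]addrC E.
  rewrite !big_nat; apply: eq_bigr => j /andP[j0 jk]; rewrite IH// -mderE//.
rewrite E; apply: vanishingD.
  by have := vanishing_iter_int (nseq k.+2 cone) (fieldc z1 v (mder (nseq k.+2 (cst_field v)) g)); rewrite size_nseq.
apply/vanishingZ/vanishing_mulr.
by have := vanishing_word_int v g (nseq k.+1 f); rewrite size_nseq.
Qed.

End Diagonal.

(** * Polarization of multilinear expressions *)

Section Polarization.
Variables (R : realType) (n : nat).
Local Notation field := (field R n).
Variable E : seq field -> 'cV[R]_n.
Hypothesis E_sum : forall m (r : seq 'I_m) (G : 'I_m -> field) s1 s2,
  E (s1 ++ fsum r G :: s2) = \sum_(i <- r) E (s1 ++ G i :: s2).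

Lemma multilinear_expand k (f : 'I_k -> field) (S : {set 'I_k}) m pre :
  E (pre ++ nseq m (fsum (enum S) f)) =
  \sum_(phi : m.-tuple 'I_k | all (mem S) phi) E (pre ++ [seq f i | i <- phi]).
Proof.
elim: m pre => [|m IH] pre.
  rewrite (big_pred1 [tuple])// => t; rewrite (tuple0 t) /=.
  by apply/esym/eqP; exact: tuple0.
rewrite E_sum [RHS]big_mkcond [RHS]big_tuple_cons big_enum /= [LHS]big_mkcond.
apply: eq_bigr => i _; case: ifP => iS /=; last by rewrite big1.
by rewrite -cat_rcons IH big_mkcond; apply: eq_bigr => phi _; rewrite cat_rcons.
Qed.

(** Toggling an element outside [B] pairs the supersets of [B] with opposite signs. *)
Lemma sum_signed_supersets k (B : {set 'I_k}) : B != finset.setT ->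
  \sum_(S : {set 'I_k} | B \subset S) (-1) ^+ #|S| = 0 :> R.
Proof.
rewrite -finset.subTset => /fintype.subsetPn[x _ xB].
set X := LHS.
pose toggle (S : {set 'I_k}) := if x \in S then S :\ x else x |: S.
have toggleK : involutive toggle.
  move=> S; rewrite /toggle; case xS: (x \in S).
    by rewrite finset.in_setD1 eqxx /= finset.setD1K.
  by rewrite finset.setU11 finset.setU1K ?xS.
have : X = - X.
  rewrite {1}/X (reindex_inj (inv_inj toggleK)) /X -sumrN; apply: eq_big => S.
    rewrite /toggle; case: ifP => xS; first by rewrite finset.subsetD1 xB andbT.
    apply/idP/idP => [BS|]; last first.
      by move=> BS; apply: fintype.subset_trans BS _; exact: finset.subsetUr.
    apply/fintype.subsetP => y yB; have := fintype.subsetP BS _ yB; rewrite finset.in_setU1 => /orP[/eqP yx|//].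
    by rewrite -yx yB in xB.
  move=> _; rewrite /toggle; case: ifP => xS.
    by rewrite [in RHS](cardsD1 x S) xS exprS mulN1r opprK.
  by rewrite cardsU1 xS exprS mulN1r.
move=> /eqP; rewrite -addr_eq0 -mulr2n mulrn_eq0 /= => /eqP; exact.
Qed.

(** Inclusion-exclusion over the sums of the fields indexed by S: an index tuple gets as weight the
    signed count of the sets containing its entries, which is zero unless the tuple is a
    permutation. *)
Lemma polarization k (f : 'I_k -> field) : (forall g, E (nseq k g) = 0) ->
  \sum_(p : 'S_k) E [seq f (p i) | i <- enum 'I_k] = 0.
Proof.
move=> E0.
have : \sum_(S : {set 'I_k}) (-1) ^+ #|S| *: E ([::] ++ nseq k (fsum (enum S) f)) = 0.
  by rewrite big1// => S _; rewrite E0 scaler0.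
under eq_bigr do rewrite multilinear_expand scaler_sumr.
rewrite (exchange_big_dep xpredT)//=.
rewrite (bigID (fun phi : k.-tuple 'I_k => uniq phi)) /= [X in _ + X]big1 ?addr0; last first.
  move=> phi nphi; rewrite -scaler_suml.
  have -> : \sum_(S : {set 'I_k} | all (mem S) phi) (-1) ^+ #|S| =
      \sum_(S : {set 'I_k} | [set x in phi]%SET \subset S) (-1) ^+ #|S| :> R.
    apply: eq_bigl => S; apply/allP/fintype.subsetP => [phiS x|phiS x xphi].
      by rewrite finset.inE => /phiS.
    by apply: phiS; rewrite finset.inE.
  rewrite sum_signed_supersets ?scale0r//; apply: contra nphi => /eqP phiT.
  by apply/card_uniqP; rewrite -cardsE phiT finset.cardsT card_ord size_tuple.
rewrite (eq_bigr (fun phi : k.-tuple 'I_k => (-1) ^+ k *: E [seq f i | i <- phi])); last first.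
  move=> phi uphi; rewrite (big_pred1 finset.setT) ?finset.cardsT ?card_ord// => S.
  apply/idP/idP => [/allP phiS|/eqP ->]; last by apply/allP => x _; exact: finset.in_setT.
  rewrite /= eqEcard finset.subsetT finset.cardsT card_ord.
  have {}uphi : #|phi| = k by move/card_uniqP: uphi => ->; rewrite size_tuple.
  apply: (@leq_trans #|phi|); first by rewrite uphi.
  exact/subset_leq_card/fintype.subsetP.
rewrite -scaler_sumr => /eqP; rewrite scaler_eq0 signr_eq0 /= => /eqP sum0; rewrite -[RHS]sum0 {sum0}.
pose h (p : 'S_k) := [tuple p i | i < k].
(* The identity is a mere default, for tuples with repetitions. *)
pose h' (phi : k.-tuple 'I_k) : 'S_k := insubd (perm (@inj_id 'I_k) : {perm 'I_k}) [ffun i => tnth phi i].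
rewrite [RHS](reindex_onto h h') => [|phi uphi].
  apply: eq_big => [p|p _]; last by congr E; rewrite (map_comp f p).
  apply/esym/andP; split; first by rewrite map_inj_uniq ?enum_uniq//; exact: perm_inj.
  apply/eqP/val_inj; rewrite /h' insubdK.
    by apply/ffunP => i; rewrite ffunE tnth_mktuple -pvalE.
  by apply/injectiveP => i j; rewrite !ffunE !tnth_mktuple; exact: perm_inj.
apply: eq_from_tnth => i; rewrite tnth_mktuple /h' -pvalE insubdK ?ffunE//.
by apply/injectiveP => a b; rewrite !ffunE; move/tuple_uniqP: uphi; apply.
Qed.

End Polarization.

(** * Permutations against distinct arrangements of a list *)

Section PermutationSums.
Variable T : eqType.
Implicit Types (ts s : seq T) (x : T).

(** Arrangements are sorted by their last letter because the recursion for word integrals appends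
    the last field. *)
Lemma sum_permutations_rcons (W : nmodType) ts (Phi : seq T -> W) : (0 < size ts)%N ->
  \sum_(s <- permutations ts) Phi s =
  \sum_(x <- undup ts) \sum_(s <- permutations (rem x ts)) Phi (rcons s x).
Proof.
move=> ts0.
transitivity (\sum_(s <- [seq rcons s x | x <- undup ts, s <- permutations (rem x ts)]) Phi s);
  last by rewrite big_allpairs_dep.
apply: perm_big; apply: uniq_perm; first exact: permutations_uniq.
  apply: allpairs_uniq_dep; first exact: undup_uniq.
    by move=> x _; exact: permutations_uniq.
  move=> p1 p2 /(@allpairsPdep _ (fun=> seq T : eqType))[x1 [s1 [_ _ ->]]].
  move=> /(@allpairsPdep _ (fun=> seq T : eqType))[x2 [s2 [_ _ ->]]] /=.
  by move=> /eqP; rewrite eqseq_rcons => /andP[/eqP -> /eqP ->].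
move=> s; rewrite mem_permutations; apply/idP/allpairsPdep => [sts|[x [s' [xts s'ts ->]]]].
  case/lastP: s sts => [/perm_size ts0'|s x sts]; first by rewrite -ts0' in ts0.
  have xts : x \in ts by rewrite -(perm_mem sts) mem_rcons mem_head.
  exists x, s; rewrite mem_undup mem_permutations; split => //.
  by rewrite -(perm_cons x) -perm_rcons (perm_trans sts)// perm_to_rem.
rewrite mem_undup in xts; rewrite mem_permutations in s'ts.
by rewrite perm_rcons (perm_trans _ (_ : perm_eq (x :: rem x ts) ts)) ?perm_cons// perm_sym perm_to_rem.
Qed.

Definition multfact ts : nat := (\prod_(x <- undup ts) (count_mem x ts)`!)%N.

Lemma multfact_gt0 ts : (0 < multfact ts)%N.
Proof. by apply: prodn_gt0 => x; exact: fact_gt0. Qed.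

Lemma multfact_rem ts x : x \in ts -> multfact ts = (count_mem x ts * multfact (rem x ts))%N.
Proof.
move=> xts; rewrite /multfact.
have E : (\prod_(y <- undup (rem x ts)) (count_mem y (rem x ts))`! =
          \prod_(y <- undup ts) (count_mem y (rem x ts))`!)%N.
  have [xr|xr] := boolP (x \in rem x ts).
    apply: perm_big; apply: uniq_perm; rewrite ?undup_uniq// => y.
    rewrite !mem_undup; have [->|yx] := eqVneq y x; first by rewrite xr xts.
    by rewrite (perm_mem (perm_to_rem xts)) inE (negbTE yx).
  have px : perm_eq (undup ts) (x :: undup (rem x ts)).
    apply: uniq_perm; rewrite ?undup_uniq//= ?mem_undup ?xr ?undup_uniq// => y.
    by rewrite mem_undup (perm_mem (perm_to_rem xts)) !inE mem_undup.
  rewrite [RHS](perm_big _ px) big_cons (count_memPn xr) fact0.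
  exact/esym/mul1n.
rewrite E (bigD1_seq x) ?mem_undup ?undup_uniq//= [in RHS](bigD1_seq x) ?mem_undup ?undup_uniq//=.
rewrite mulnA; congr (_ * _)%N; last first.
  by apply: eq_bigr => y yx; rewrite count_mem_rem eq_sym (negbTE yx) subn0.
rewrite count_mem_rem eqxx subn1; have := xts; rewrite -has_pred1 has_count.
by case: (count_mem x ts) => // c _; rewrite factS.
Qed.

(** The multinomial count, by removing the last letter: this divides [multfact] by the multiplicity
    of that letter, and the multiplicities add up to the length. *)
Lemma size_permutations_multfact ts : (size (permutations ts) * multfact ts = (size ts)`!)%N.
Proof.
move Ek : (size ts) => k; elim: k ts Ek => [|k IH] ts sk.
  by rewrite (size0nil sk) /multfact /= big_nil.
have -> : size (permutations ts) = (\sum_(x <- undup ts) size (permutations (rem x ts)))%N.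
  rewrite -sum1_size (sum_permutations_rcons (fun=> 1%N)) ?sk//.
  by apply: eq_bigr => x _; rewrite sum1_size.
rewrite big_distrl /= factS -{1}sk.
have -> : size ts = (\sum_(x <- undup ts) count_mem x ts)%N.
  rewrite -sum1_size; under [RHS]eq_bigr do rewrite -sum1_count big_mkcond.
  rewrite exchange_big big_seq [RHS]big_seq; apply: eq_bigr => y yts.
  rewrite -big_mkcond sum1_count (@eq_count _ _ (pred1 y)) => [|x]; last by rewrite /= eq_sym.
  by rewrite count_uniq_mem ?undup_uniq// mem_undup yts.
rewrite big_distrl /= big_seq [RHS]big_seq; apply: eq_bigr => x; rewrite mem_undup => xts.
by rewrite (multfact_rem xts) mulnCA IH// size_rem// sk.
Qed.

Variable x0 : T.

Definition perm_word k ts (p : 'S_k) : seq T := [seq nth x0 ts (p i) | i <- enum 'I_k].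

Lemma perm_word_perm k ts (p : 'S_k) : size ts = k -> perm_eq (perm_word ts p) ts.
Proof.
move=> sk; have tsE : ts = [seq nth x0 ts (val i) | i <- enum 'I_k].
  by rewrite -[LHS](mkseq_nth x0) sk /mkseq -val_enum_ord -map_comp.
rewrite /perm_word [X in perm_eq _ X]tsE (map_comp (fun i : 'I_k => nth x0 ts i) p).
apply: perm_map; apply: uniq_perm; rewrite ?enum_uniq//.
  by rewrite map_inj_uniq ?enum_uniq//; exact: perm_inj.
move=> i; rewrite mem_enum; apply/mapP; exists (p^-1 i)%g; rewrite ?mem_enum//.
by rewrite permKV.
Qed.

Lemma perm_word_surj k ts s : size ts = k -> perm_eq s ts ->
  exists p : 'S_k, perm_word ts p = s.
Proof.
move=> sk sts; have st : size ts == k by rewrite sk.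
have /tuple_permP[p Ep] : perm_eq s (Tuple st) by [].
exists p; rewrite Ep /perm_word; apply: eq_map => i.
by rewrite (tnth_nth x0).
Qed.

Lemma perm_word_eq k ts s (p : 'S_k) : size s = k ->
  (perm_word ts p == s) = [forall i : 'I_k, nth x0 ts (p i) == nth x0 s i].
Proof.
move=> sk; have sE : s = [seq nth x0 s (val i) | i <- enum 'I_k].
  by rewrite -[LHS](mkseq_nth x0) sk /mkseq -val_enum_ord -map_comp.
rewrite /perm_word [X in _ == X]sE; apply/eqP/forallP => [/eq_in_map E i|E].
  by apply/eqP/E; rewrite mem_enum.
by apply: eq_map => i; exact/eqP.
Qed.

Lemma sum_perm_word_fibers (W : nmodType) k ts (Phi : seq T -> W) : size ts = k ->
  \sum_(p : 'S_k) Phi (perm_word ts p) =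
  \sum_(s <- permutations ts) \sum_(p : 'S_k | perm_word ts p == s) Phi s.
Proof.
move=> sk; rewrite (exchange_big_dep xpredT)//=; apply: eq_bigr => p _.
rewrite (eq_bigl (pred1 (perm_word ts p))) => [|s]; last by rewrite /= eq_sym.
rewrite -big_filter filter_pred1_uniq ?permutations_uniq ?big_seq1//.
by rewrite mem_permutations perm_word_perm.
Qed.

(** Translation in the symmetric group identifies all fibres, and their common size follows from the
    total number k! of permutations. *)
Lemma card_perm_word k ts s : size ts = k -> perm_eq s ts ->
  #|[pred p : 'S_k | perm_word ts p == s]| = multfact ts.
Proof.
move=> sk; pose c := #|[pred p : 'S_k | perm_word ts p == ts]|.
have cE s' : perm_eq s' ts -> #|[pred p : 'S_k | perm_word ts p == s']| = c.
  move=> s'ts; have [p0 Ep0] := perm_word_surj sk s'ts.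
  have s'k : size s' = k by rewrite (perm_size s'ts).
  rewrite /c -!sum1_card (reindex_inj (mulgI p0)); apply: eq_bigl => q.
  rewrite !inE !perm_word_eq//; have /eqP := Ep0; rewrite perm_word_eq// => /forallP Ep.
  apply/forallP/forallP => E i.
    by have := E (p0^-1 i)%g; rewrite permM permKV -(eqP (Ep _)) permKV.
  by rewrite permM -(eqP (Ep i)).
move=> sts; rewrite (cE s sts); apply/eqP.
have p0 : (0 < size (permutations ts))%N.
  by rewrite lt0n size_eq0; apply/eqP => E; have := mem_permutations ts ts; rewrite E perm_refl.
rewrite -(eqn_pmul2l p0) size_permutations_multfact sk.
have := @sum_perm_word_fibers nat k ts (fun=> 1%N) sk.
rewrite sum1_card card_Sn => ->; rewrite -sum1_size big_distrl big_seq [X in _ == X]big_seq.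
apply/eqP; apply: eq_bigr => s'; rewrite mem_permutations => s'ts.
by rewrite sum1_card -(cE s')//; exact: mul1n.
Qed.

Lemma sum_perm_words (W : nmodType) k ts (Phi : seq T -> W) : size ts = k ->
  \sum_(p : 'S_k) Phi (perm_word ts p) =
  \sum_(s <- permutations ts) Phi s *+ multfact ts.
Proof.
move=> sk; rewrite sum_perm_word_fibers// big_seq [RHS]big_seq; apply: eq_bigr => s.
by rewrite mem_permutations => sts; rewrite sumr_const -(card_perm_word sk sts).
Qed.

End PermutationSums.

(** * Sorted permutations as representatives of arrangements *)

Section SortedPerms.
Variables (d : nat) (ts : seq (tree d)) (x0 : tree d).
Local Notation k := (size ts).
Local Notation word := (perm_word x0 ts).
Implicit Types p q : 'S_(size ts).

Lemma permsP p : reflect (forall i j : 'I_k, (i < j)%N ->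
    nth x0 ts (p i) = nth x0 ts (p j) -> (p i < p j)%N) (p \in perms ts).
Proof.
rewrite finset.inE; apply: (iffP forallP) => [H i j ij pij|H i].
  by move/forallP: (H i) => /(_ j); rewrite ij !(tnth_nth x0) /= pij eqxx.
apply/forallP => j; apply/implyP => /andP[ij].
by rewrite !(tnth_nth x0) => /eqP; exact: H.
Qed.

Lemma perm_wordP p q : word p = word q -> forall i, nth x0 ts (p i) = nth x0 ts (q i).
Proof. by move=> /eq_in_map pq i; apply: pq; rewrite mem_enum. Qed.

(** Otherwise the value [p i] is taken by [q] only after [i], on an equal letter, which breaks the
    increasing order required of [q]. *)
Lemma perms_word_le p q (i : 'I_k) : q \in perms ts -> word p = word q ->
  (forall j : 'I_k, (j < i)%N -> p j = q j) -> ~ (p i < q i)%N.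
Proof.
move=> /permsP qP /perm_wordP pq IH piqi.
pose j := (q^-1 (p i))%g; have qj : q j = p i by rewrite permKV.
have [ji|ij|ij] := ltngtP j i.
- by have := IH j ji; rewrite qj => /perm_inj jE; rewrite jE ltnn in ji.
- have := qP i j ij; rewrite qj pq => /(_ erefl) qi.
  by have := ltn_trans qi piqi; rewrite ltnn.
- by move: qj; rewrite (val_inj ij) => E; rewrite E ltnn in piqi.
Qed.

Lemma perms_word_inj : {in perms ts &, injective word}.
Proof.
move=> p q pP qP pq; apply/permP => i.
move Em : (val i) => m; elim/ltn_ind: m i Em => m IH i im.
have IH' (j : 'I_k) : (j < i)%N -> p j = q j.
  by rewrite -[val i]/(val i) im => jm; exact: (IH j).
have [|/(perms_word_le pP (esym pq))|/val_inj//] := ltngtP (p i) (q i).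
  by move/(perms_word_le qP pq IH').
by case=> j ji; exact/esym/IH'.
Qed.

Lemma perms_word_surj s : perm_eq s ts -> exists2 p, p \in perms ts & word p = s.
Proof.
move=> /(perm_word_surj x0 erefl)[p0 /eqP Ep0].
(* The rearrangement inequality: exchanging two decreasing values on equal letters keeps the word
   and raises the sum of i p(i), so a maximizer is sorted. *)
have [p /eqP Ep pmax] := @arg_maxnP _ p0 (fun p => word p == s)
  (fun p : 'S_k => \sum_(i : 'I_k) i * p i)%N Ep0.
exists p => //; apply/permsP => i j ij tij; rewrite ltnNge leq_eqVlt; apply/negP.
case/orP => [/eqP/val_inj/perm_inj ji|pji]; first by rewrite ji ltnn in ij.
pose q := (tperm i j * p)%g.
have Eq : word q = s.
  rewrite -Ep; apply: eq_map => x; rewrite permM.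
  by case: tpermP => [->|->|//]; rewrite tij.
have := pmax q (introT eqP Eq); apply/negP; rewrite -ltnNge.
have ji : j != i by apply/eqP => E; rewrite E ltnn in ij.
rewrite (bigD1 i)//= (bigD1 j)//= [in X in (_ < X)%N](bigD1 i)//= [in X in (_ < X)%N](bigD1 j)//=.
rewrite !permM tpermL tpermR !addnA.
rewrite (eq_bigr (fun x : 'I_k => (x * q x)%N)) => [|x /andP[xi xj]]; last first.
  by rewrite permM tpermD// eq_sym.
rewrite ltn_add2r; move: ij pji; set a := val i; set b := val j.
rewrite -/a -/b; move: (val (p i)) (val (p j)) => c e; nia.
Qed.

Lemma sum_perms (W : nmodType) (Phi : seq (tree d) -> W) :
  \sum_(p in perms ts) Phi (word p) = \sum_(s <- permutations ts) Phi s.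
Proof.
rewrite -big_enum -[LHS](big_map word xpredT Phi); apply: perm_big; apply: uniq_perm.
- by rewrite map_inj_in_uniq ?enum_uniq// => p q; rewrite !mem_enum; exact: perms_word_inj.
- exact: permutations_uniq.
move=> s; rewrite mem_permutations; apply/mapP/idP => [[p _ ->]|].
  exact: perm_word_perm.
by move=> /perms_word_surj[p pP <-]; exists p; rewrite ?mem_enum.
Qed.

End SortedPerms.

(** * Lebesgue integrals over the simplex as iterated primitives *)

Section SimplexIntegrals.
Variable R : realType.

(* [V b] is the iterated integral of [f] up to [b], the iterated integrands being
   continuous, so that the integrals can be computed by primitives. *)
Fixpoint has_int (N : nat) (f : seq R -> R) (V : R -> R) : Prop :=
  if N is N'.+1 then
    exists W : R -> R -> R, [/\ forall t, has_int N' (fun s => f (t :: s)) (W t),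
      continuous (fun t => W t t), forall t : R, is_derive t 1 V (W t t) & V 0 = 0]
  else forall b, V b = f [::].

Lemma has_int_simplex N f V b : has_int N f V -> 0 <= b -> simplex_int N b f = V b.
Proof.
elim: N f V b => [|N IH] f V b /=; first by move=> ->.
move=> [W [fW cW dV V0]] b0.
transitivity (\int[lebesgue_measure]_(t in `[0, b]) W t t).
  apply: eq_Rintegral => t; rewrite inE /= in_itv /= => /andP[t0 _]; exact: IH.
by rewrite integral_primitive// -(derivative_unique dV V0 cW).
Qed.

Lemma has_int_sum N I (s : seq I) (P : pred I) (c : I -> R) (f : I -> seq R -> R) V :
  (forall i, has_int N (f i) (V i)) ->
  has_int N (fun t => \sum_(i <- s | P i) c i * f i t)
    (fun b => \sum_(i <- s | P i) c i * V i b).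
Proof.
elim: N f V => [|N IH] f V fV /=.
  by move=> b; apply: eq_bigr => i _; rewrite fV.
have [W WP] := choice fV.
exists (fun t b => \sum_(i <- s | P i) c i * W i t b); split.
- move=> t; apply: (IH (fun i s => f i (t :: s))) => i.
  by case: (WP i) => fW _ _ _; exact: fW.
- apply: continuous_bigsum => i x; apply: continuousM; first exact: cst_continuous.
  by case: (WP i) => _ cW _ _; apply: cW.
- move=> t; apply: is_derive_bigsum => i; case: (WP i) => _ _ dV _.
  exact: (is_derive_ext (is_deriveZ (c i) (dV t)) (fun=> erefl) erefl).
- by rewrite big1// => i _; case: (WP i) => _ _ _ ->; rewrite mulr0.
Qed.

Lemma eq_has_int N f g V U : f =1 g -> V =1 U -> has_int N f V -> has_int N g U.
Proof. by move=> /funext -> /funext ->. Qed.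

Variable n : nat.

Fixpoint curves_prod (Bs : seq (curve R n n)) (s : seq R) : 'M[R]_n :=
  if Bs is B :: Bs' then B (head 0 s) *m curves_prod Bs' (behead s) else 1%:M.

Lemma has_int_prod Bs a c :
  has_int (size Bs) (fun s => curves_prod Bs s a c) (fun t => iter_int Bs (ccst 1%:M) t a c).
Proof.
elim: Bs a => [//|B Bs IH] a /=.
(* The upper bound [b] of the inner integral is kept apart from the outer time [t], and set equal to
   it only when the outer integral is taken. *)
exists (fun t b => \sum_e B t a e * iter_int Bs (ccst 1%:M) b e c); split.
- move=> t; have := has_int_sum (index_enum _) xpredT (fun e => B t a e) (fun e => IH e).
  by apply: eq_has_int => // s; rewrite mxE.
- by apply: continuous_bigsum => e x; apply: continuousM; exact: ccont.
- move=> t; apply: (is_derive_ext (mprimP _ a c t)) => //=.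
  by rewrite mxE.
- by rewrite mprim0 mxE.
Qed.

Lemma curves_prod_rcons Bs B s : curves_prod (rcons Bs B) s = curves_prod Bs s *m B (nth 0 s (size Bs)).
Proof.
elim: Bs s => [|B' Bs IH] s /=; first by rewrite mulmx1 mul1mx nth0.
by rewrite IH mulmxA nth_behead.
Qed.

Lemma curves_prod_place N js As s : sorted ltn js -> all (fun a => a < N)%N js ->
  size As = size js ->
  curves_prod (place N js As) s =
  \prod_(i < size js) nth cone As i (nth 0 s (nth 0%N js i)) :> 'M[R]_n.
Proof.
elim: N js As => [|N IH] js As.
  by case: js => [|//] _ _ /size0nil ->; rewrite big_ord0.
move=> sjs jsN sA; rewrite place_rcons curves_prod_rcons size_map size_iota.
case/lastP: js sjs jsN sA => [|js j] sjs jsN sA.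
  by rewrite (IH [::])// place_notin// mulmx1.
move/sorted_rcons_ltn: (sjs) => /andP[sjs' jsj].
move: jsN; rewrite all_rcons ltnS leq_eqVlt => /andP[/orP[/eqP jN|jN] jsN]; last first.
  rewrite place_notin ?mulmx1//.
    rewrite IH// all_rcons jN; apply/allP => a /(allP jsj) aj; exact: ltn_trans aj jN.
  rewrite mem_rcons inE negb_or gtn_eqF//=; apply: all_ltn_notin.
  by apply/allP => a /(allP jsj) aj; exact: ltn_trans aj jN.
subst j; case/lastP: As sA => [|As A]; first by rewrite size_rcons.
rewrite !size_rcons => -[sA]; rewrite place_rcons_rcons// IH//.
rewrite big_ord_recr /= !nth_rcons sA ltnn eqxx -(cats1 js) index_cat.
rewrite (negbTE (all_ltn_notin jsj)) /= eqxx addn0 ltnn eqxx.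
congr (_ *m _); apply: eq_bigr => i _; rewrite nth_rcons sA ltn_ord nth_cat ltn_ord//.
Qed.

End SimplexIntegrals.

(** * The matrix H as a sum of word integrals *)

Section RemainderMatrix.
Variables (R : realType) (n d : nat) (sigma : 'I_d -> 'cV[R]_n -> 'cV[R]_n).
Hypothesis smooth_sigma : forall j, smooth (sigma j).
Variables (z1 z2 : 'cV[R]_n).
Local Notation tfield := (tfield smooth_sigma).
Local Notation h := (z2 - z1).

Lemma eA_curves taus k r t :
  eA sigma z1 z2 taus k r t =
  \sum_(1 <= l < (mL r).+2) (-1) ^+ (1 < l)%N *:
    \sum_(j <- words k.+1 l | sorted ltn j) (J r j)%:R *:
      curves_prod (place k.+1 j [seq gradc z1 h f | f <- cut_fields (tfield \o taus) r l]) t.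
Proof.
rewrite /eA [LHS]big_nat [RHS]big_nat; apply: eq_bigr => l; rewrite ltnS => lr; congr (_ *: _).
rewrite -(@big_tuple_words _ _ _ (sorted ltn) (fun j => (J r j)%:R *:
      curves_prod (place k.+1 j [seq gradc z1 h f | f <- cut_fields (tfield \o taus) r l]) t)).
apply: eq_bigr => j sj; congr (_ *: _).
have sl : size (map val j) = l by rewrite size_map size_tuple.
have sc : size (cut_fields (tfield \o taus) r l) = l by rewrite size_map size_cut.
have := @curves_prod_place R n k.+1 (map val j)
  [seq gradc z1 h f | f <- cut_fields (tfield \o taus) r l] t sj.
rewrite size_map sc sl => -> //; last first.
  by rewrite all_map; apply/allP => i _ /=.
apply: eq_bigr => i _.
rewrite (nth_map (cst_field 0)) ?sc// (nth_map (BLeaf 0)) ?size_cut//.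
rewrite (nth_map ord0) ?size_tuple// -tnth_nth /= /line; congr (grad _ _).
by apply/funext => z; rewrite elem_lcE lcfield_Gtree.
Qed.

Lemma simplex_eA taus k r a b :
  simplex_int k.+1 1 (fun t => eA sigma z1 z2 taus k r t a b) =
  tree_int z1 h (tfield \o taus) k.+1 r 1 a b.
Proof.
pose Bs l j := place k.+1 j [seq gradc z1 h f | f <- cut_fields (tfield \o taus) r l].
have hj l j : has_int k.+1 (fun t => curves_prod (Bs l j) t a b)
    (fun t => iter_int (Bs l j) (ccst 1%:M) t a b).
  by have := has_int_prod (Bs l j) a b; rewrite size_map size_iota.
have hl l := has_int_sum (words k.+1 l) (sorted ltn) (fun j => (J r j)%:R) (fun j => hj l j).
have hr := has_int_sum (index_iota 1 (mL r).+2) xpredT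
   (fun l => (-1) ^+ (1 < l)%N) (fun l => hl l).
apply: (@has_int_simplex _ _ _ (fun t => tree_int z1 h (tfield \o taus) k.+1 r t a b)) => //.
apply: eq_has_int hr => t; rewrite ?eA_curves summxE; apply: eq_bigr => l _.
  by rewrite [RHS]mxE summxE; congr (_ * _); apply: eq_bigr => j _; rewrite [RHS]mxE.
by rewrite [RHS]mxE summxE; congr (_ * _); apply: eq_bigr => j _; rewrite [RHS]mxE.
Qed.

Lemma fsum_Tb (W : nmodType) I (G : btree -> W) :
  \sum_(r \in Tb I) G r = \sum_(r <- trees_with_leaves (rev I)) G r.
Proof.
suff -> : Tb I = [set` trees_with_leaves (rev I)].
  by rewrite -fsbig_seq//; exact: uniq_trees_with_leaves.
apply/seteqP; split => r; rewrite /Tb /= mem_trees_with_leaves.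
  by move=> E; rewrite -[bleaves r]revK E rev_cons.
by move=> /eqP ->; rewrite rev_rcons revK.
Qed.

Lemma word_int_nil g t : word_int z1 h g [::] t = mprim (gradc z1 h g) t.
Proof.
rewrite /word_int /forest_int big_seq1 /tree_sign /= expr0 scale1r /tree_int /= big_nat1.
rewrite expr0 scale1r big_mkcond big_seq1 /= /J /= scale1r.
rewrite /tree_word_int /cut_fields cut1 /=.
by apply: mprim_ext => s; rewrite /= mulmx1.
Qed.

(** Sorted permutations produce every distinct arrangement once, so the sum over p is a sum over
    words of trees, and H depends on [ts] only as a multiset. *)
Lemma H_word ts tau0 :
  H sigma z1 z2 ts tau0 =
  \sum_(s <- permutations ts) word_int z1 h (tfield tau0) (map tfield s) 1.
Proof.
rewrite /H; case: eqP => [/size0nil ->|/eqP k0].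
  rewrite big_seq1 word_int_nil; apply/matrixP => a b; rewrite mxE mprimE.
  rewrite -(@integral_primitive R (fun t => gradc z1 h (tfield tau0) t a b) 1 (@ccont _ _ _ _ a b) ler01).
  apply: eq_Rintegral => t _ /=; rewrite /line; congr (grad _ _ a b).
  by apply/funext => z; rewrite elemE.
rewrite -(@sum_perms _ ts tau0 _ (fun s => word_int z1 h (tfield tau0) (map tfield s) 1)).
apply: eq_bigr => p _; rewrite fsum_Tb.
pose F := tfield \o nth tau0 (tau0 :: ts).
have -> : word_int z1 h (tfield tau0) (map tfield (perm_word tau0 ts p)) 1 =
    forest_int z1 h F (rev [seq (p i).+1 | i : 'I_(size ts)]) 1.
  rewrite forest_int_word revK; congr (word_int _ _ _ _ _).
  by rewrite -!map_comp; apply: eq_map.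
rewrite /forest_int [LHS]big_seq [RHS]big_seq; apply: eq_bigr => r.
rewrite mem_trees_with_leaves => /eqP Er.
have sr : size (bleaves r) = (size ts).+1.
  by rewrite Er size_rcons size_rev size_map size_enum_ord.
rewrite /tree_sign sr /= size_rev size_map size_enum_ord; congr (_ *: _).
by apply/matrixP => a b; rewrite [LHS]mxE; exact: simplex_eA.
Qed.

End RemainderMatrix.

(** * Finite enumerations of trees and forests of bounded size *)

Section Enumeration.
Variable d : nat.

Fixpoint lists_upto (T : Type) (A : seq T) n : seq (seq T) :=
  if n is n'.+1 then [::] :: [seq x :: s | x <- A, s <- lists_upto A n'] else [:: [::]].

Lemma mem_lists_upto (T : eqType) (A : seq T) n s :
  {subset s <= A} -> (size s <= n)%N -> s \in lists_upto A n.
Proof.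
elim: n s => [|n IH] [|x s] //= sA sn; rewrite ?inE//.
apply/orP; right; apply/allpairsP; exists (x, s); split => //=.
  by apply: sA; rewrite mem_head.
by apply: IH => // y ys; apply: sA; rewrite in_cons ys orbT.
Qed.

(** A superset is enough, as it is filtered by size later: a tree with at most m vertices has at
    most m - 1 children, each with at most m - 1 vertices. *)
Fixpoint ptrees_upto m : seq (ptree d) :=
  if m is m'.+1 then [seq PNode i s | i <- enum 'I_d, s <- lists_upto (ptrees_upto m') m']
  else [::].

Lemma psize_gt0 (p : ptree d) : (0 < psize p)%N. Proof. by case: p. Qed.

Lemma mem_ptrees_upto m p : (psize p <= m)%N -> p \in ptrees_upto m.
Proof.
elim: m p => [|m IH] [i s] //=; rewrite ltnS => sm.
apply/allpairsP; exists (i, s); split => //=; first exact: mem_enum.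
apply: mem_lists_upto => [u us|].
  apply: IH; apply: leq_trans sm; rewrite sumnE big_map.
  by rewrite (big_rem u us) /= leq_addr.
apply: leq_trans sm; rewrite sumnE big_map -sum1_size.
by apply: leq_sum => u _; exact: psize_gt0.
Qed.

Lemma enum_trees m : exists2 ts : seq (tree d), uniq ts & forall t, (t \in ts) = (tsize t <= m)%N.
Proof.
exists (undup [seq t <- [seq (\pi_(tree d) p)%qT | p <- ptrees_upto m] | (tsize t <= m)%N]).
  exact: undup_uniq.
move=> t; rewrite mem_undup mem_filter andb_idr// => tm.
by apply/mapP; exists (repr t); rewrite ?reprK//; exact: mem_ptrees_upto.
Qed.

Lemma tsize_gt0 (t : tree d) : (0 < tsize t)%N. Proof. exact: psize_gt0. Qed.

Lemma tsize_le_fsize (t : tree d) (w : forest d) : t \in w -> (tsize t <= fsize w)%N.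
Proof. by move=> tw; rewrite /fsize (big_rem t)//= leq_addr. Qed.

Lemma enum_forests m : exists2 ws : seq (forest d), uniq ws &
  forall w, (w \in ws) = (fsize w <= m)%N.
Proof.
have [ts _ tsP] := enum_trees m.
exists (undup [seq w <- [seq seq_mset s | s <- lists_upto ts m] | (fsize w <= m)%N]).
  exact: undup_uniq.
move=> w; rewrite mem_undup mem_filter andb_idr// => wm.
apply/mapP; exists (enum_mset w); last by rewrite seq_mset_id.
apply: mem_lists_upto => [t tw|].
  by rewrite tsP (leq_trans (tsize_le_fsize tw)).
apply: leq_trans wm; rewrite -sum1_size.
by apply: leq_sum => t _; exact: tsize_gt0.
Qed.

Local Open Scope mset_scope.

Lemma perm_enum_msetD1 (t : tree d) (w : forest d) :
  perm_eq (enum_mset (t +` w)) (t :: enum_mset w).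
Proof.
by apply/allP => x _; rewrite /= !count_mem_mset mset1DE [t == x]eq_sym.
Qed.

Lemma perm_rem_msetD1 (t : tree d) (w : forest d) :
  perm_eq (rem t (enum_mset (t +` w))) (enum_mset w).
Proof.
have := perm_enum_msetD1 t w => p.
have tw : t \in enum_mset (t +` w) by rewrite (perm_mem p) mem_head.
by rewrite -(perm_cons t) -(permPl (perm_to_rem tw)).
Qed.

Lemma fsizeD1 (t : tree d) (w : forest d) : fsize (t +` w) = (tsize t + fsize w)%N.
Proof. by rewrite /fsize (perm_big _ (perm_enum_msetD1 t w)) big_cons. Qed.

Lemma multfact_mset (w : forest d) : multfact (enum_mset w) = symfact w.
Proof.
rewrite /multfact /symfact (perm_big _ (perm_undup_mset w)).
by apply: eq_bigr => t _; rewrite count_mem_mset.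
Qed.

End Enumeration.

(** * The recursion for H *)

Section RemainderRecursion.
Variables (R : realType) (n d : nat) (sigma : 'I_d -> 'cV[R]_n -> 'cV[R]_n).
Hypothesis smooth_sigma : forall j, smooth (sigma j).
Variables (z1 z2 : 'cV[R]_n) (tau0 : tree d).
Local Notation tfield := (tfield smooth_sigma).
Local Notation h := (z2 - z1).
Local Notation H ts := (H sigma z1 z2 ts tau0).

Lemma perm_H ts ts' : perm_eq ts ts' -> H ts = H ts'.
Proof.
by move=> tt'; rewrite !(H_word smooth_sigma); apply: perm_big; exact: perm_permutations.
Qed.

(** The difference between [word_coef] and [mder] is additive in each field and zero on the
    diagonal, so its symmetrization vanishes; [mder] is already symmetric, and the scalar is the
    number of distinct arrangements. *)
Lemma sum_word_coef ts : (0 < size ts)%N ->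
  \sum_(s <- permutations ts) word_coef z1 (tfield tau0) (map tfield s) =
  ((size ts)`!%:R / (multfact ts)%:R) *: mder (map tfield ts) (tfield tau0) z1.
Proof.
move=> k0; set k := size ts; set g := tfield tau0.
pose E fs := word_coef z1 g fs - mder fs g z1.
have E_sum m (r : seq 'I_m) G s1 s2 :
    E (s1 ++ fsum r G :: s2) = \sum_(i <- r) E (s1 ++ G i :: s2).
  by rewrite /E word_coef_sum mder_add -sumrB.
have Ediag f : E (nseq k f) = 0 by rewrite /E word_coef_diag// subrr.
have := polarization E_sum (fun i : 'I_k => tfield (nth tau0 ts i)) Ediag.
have Ew (p : 'S_k) : [seq tfield (nth tau0 ts (p i)) | i <- enum 'I_k] =
    map tfield (perm_word tau0 ts p) by rewrite /perm_word -[RHS]map_comp; exact: eq_map.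
under eq_bigr do rewrite Ew.
rewrite (sum_perm_words tau0 (fun s => E (map tfield s)) erefl) sumrMnl.
rewrite -scaler_nat => /eqP; rewrite scaler_eq0 pnatr_eq0 gtn_eqF ?multfact_gt0//= /E.
rewrite sumrB subr_eq0 => /eqP ->.
transitivity (\sum_(s <- permutations ts) mder (map tfield ts) g z1).
  rewrite big_seq [RHS]big_seq; apply: eq_bigr => s; rewrite mem_permutations => sts.
  by rewrite (mder_perm _ _ sts).
rewrite big_const_seq count_predT iter_addr_0 -scaler_nat; congr (_ *: _).
by rewrite -size_permutations_multfact natrM mulfK// pnatr_eq0 -lt0n multfact_gt0.
Qed.

Lemma H_nil : H [::] *m h = tfield tau0 z2 - tfield tau0 z1.
Proof.
rewrite (H_word smooth_sigma) big_seq1 word_int0 /line scale1r.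
by rewrite [z1 + _]addrC subrK.
Qed.

Lemma H_rec ts : (0 < size ts)%N -> H ts *m h =
  \sum_(x <- undup ts) H (rem x ts) *m tfield x z1 -
  (multfact ts)%:R^-1 *: mder (map tfield ts) (tfield tau0) z1.
Proof.
move=> k0; set g := tfield tau0.
rewrite (H_word smooth_sigma) sum_permutations_rcons// mulmx_suml.
under eq_bigr do rewrite mulmx_suml.
apply/eqP; rewrite -subr_eq opprK; apply/eqP.
(* At t = 1 the simplex volume 1/k! cancels the k! of [sum_word_coef]. *)
have -> : (multfact ts)%:R^-1 *: mder (map tfield ts) g z1 =
  \sum_(s <- permutations ts) vol (size ts) 1 *: word_coef z1 g (map tfield s).
  rewrite -scaler_sumr sum_word_coef// scalerA; congr (_ *: _).
  by rewrite /vol expr1n mulrA divfK ?mul1r// pnatr_eq0 -lt0n fact_gt0.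
rewrite sum_permutations_rcons// -big_split.
rewrite [LHS]big_seq [RHS]big_seq; apply: eq_bigr => x; rewrite mem_undup => xts.
rewrite (H_word smooth_sigma) mulmx_suml -big_split.
rewrite [LHS]big_seq [RHS]big_seq; apply: eq_bigr => s; rewrite mem_permutations => sts.
rewrite word_int_rec map_rcons; congr (_ + vol _ _ *: _).
by rewrite size_map (perm_size sts) size_rem// prednK.
Qed.

End RemainderRecursion.

(** * Reindexing pairs of a tree and a forest by their product *)

Section ForestSums.
Variables (d m : nat) (W : nmodType) (ts : seq (tree d)) (ws : seq (forest d)).
Hypotheses (ts_uniq : uniq ts) (ts_tsize : forall t, (t \in ts) = (tsize t <= m)%N).
Hypotheses (ws_uniq : uniq ws) (ws_fsize : forall w, (w \in ws) = (fsize w <= m)%N).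

Lemma fsbig_enum (T : choiceType) (s : seq T) (P : pred T) (F : T -> W) :
  uniq s -> (forall x, (x \in s) = P x) -> \sum_(x \in [set x | P x]) F x = \sum_(x <- s) F x.
Proof.
move=> us sP; rewrite [RHS]fsbig_seq// (_ : [set x | P x] = [set` s])//.
by apply/seteqP; split => x /=; rewrite sP.
Qed.

Local Open Scope mset_scope.

Lemma sum_graft_root t (Psi : forest d -> W) : t \in ts ->
  \sum_(w <- ws | (tsize t <= m - fsize w)%N) Psi (t +` w) = \sum_(w <- ws | t \in w) Psi w.
Proof.
move=> tts; rewrite -[LHS]big_filter -[RHS]big_filter -(big_map (fun w => t +` w) xpredT).
have t0 := tsize_gt0 t.
have injt : injective (fun w : forest d => t +` w) by move=> w w' /(congr1 (fun x => x `\ t)); rewrite !msetD1K.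
apply: perm_big; apply: uniq_perm; rewrite ?map_inj_uniq ?filter_uniq// => w.
rewrite mem_filter ws_fsize; apply/mapP/andP => [[w' ]|[tw wm]].
  rewrite mem_filter ws_fsize => /andP[tm wm] ->.
  by split; [rewrite in_mset1D eqxx|rewrite fsizeD1; lia].
have Ew : w = t +` (w `\ t) by rewrite msetB1K.
by exists (w `\ t) => //; rewrite mem_filter ws_fsize; move: wm; rewrite {1}Ew fsizeD1; lia.
Qed.

Lemma exchange_graft_root (Psi : tree d -> forest d -> W) :
  \sum_(w <- ws) \sum_(t <- ts | (tsize t <= m - fsize w)%N) Psi t (t +` w) =
  \sum_(w <- ws) \sum_(t <- undup (enum_mset w)) Psi t w.
Proof.
transitivity (\sum_(w <- ws) \sum_(t <- ts | t \in w) Psi t w).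
  rewrite [LHS](exchange_big_dep xpredT)// [RHS](exchange_big_dep xpredT)//.
  rewrite [LHS]big_seq [RHS]big_seq.
  by apply: eq_bigr => t tts; exact: sum_graft_root.
rewrite [LHS]big_seq [RHS]big_seq; apply: eq_bigr => w; rewrite ws_fsize => wm.
rewrite -big_filter; apply: perm_big; apply: uniq_perm; rewrite ?filter_uniq ?undup_uniq// => t.
rewrite mem_filter mem_undup ts_tsize andb_idr// => tw.
exact: leq_trans (tsize_le_fsize tw) wm.
Qed.

End ForestSums.

Theorem theorem4p36 (R : realType) (n d m : nat)
    (sigma : 'I_d -> 'cV[R]_n -> 'cV[R]_n) (z1 z2 : 'cV[R]_n)
    (tau0 : tree d) (X : forest d -> R)
    (smooth_sigma : forall j, smooth (sigma j))
    (multX : multiplicative m X) :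
  elem sigma tau0 z2 -
  \sum_(w \in [set w : forest d | (fsize w <= m)%N])
     (X w / (symfact w)%:R) *: elem_lc sigma (graft_forest R w tau0) z1
  = \sum_(w \in [set w : forest d | (fsize w <= m)%N])
     X w *: (H sigma z1 z2 (enum_mset w) tau0 *m remainder sigma X z1 z2 (m - fsize w)).
Proof.
have [ts tsu tsP] := @enum_trees d m; have [ws wsu wsP] := @enum_forests d m.
have [X0 XD] := multX; pose g := tfield smooth_sigma; pose h := z2 - z1.
pose Hw w := H sigma z1 z2 w tau0.
have remE j : (j <= m)%N -> remainder sigma X z1 z2 j =
    h - \sum_(t <- ts | (tsize t <= j)%N) X [mset t]%mset *: g t z1.
  move=> jm; rewrite /remainder -[in RHS]big_filter; congr (_ - _).
  rewrite (@fsbig_enum _ _ [seq t <- ts | (tsize t <= j)%N]) ?filter_uniq//.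
    by apply: eq_bigr => t _; rewrite (elemE smooth_sigma).
  by move=> t; rewrite mem_filter tsP andb_idr// => tj; exact: leq_trans jm.
rewrite (elemE smooth_sigma) !(fsbig_enum _ wsu wsP).
have -> : \sum_(w <- ws) X w *: (Hw (enum_mset w) *m remainder sigma X z1 z2 (m - fsize w)) =
    \sum_(w <- ws) X w *: (Hw (enum_mset w) *m h) - \sum_(w <- ws)
      \sum_(t <- ts | (tsize t <= m - fsize w)%N)
        X (t +` w)%mset *: (Hw (rem t (enum_mset (t +` w)%mset)) *m g t z1).
  rewrite -sumrB [LHS]big_seq [RHS]big_seq; apply: eq_bigr => w; rewrite wsP => wm.
  rewrite remE ?leq_subr// mulmxBr scalerBr mulmx_sumr scaler_sumr; congr (_ - _).
  (* The sizes of [t] and [w] add up to at most [m], the range in which [X] is multiplicative. *)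
  apply: eq_bigr => t tw; rewrite XD; last by rewrite -/(t +` w)%mset fsizeD1; lia.
  rewrite /Hw (perm_H smooth_sigma _ _ _ (perm_rem_msetD1 t w)).
  by rewrite -scalemxAr scalerA mulrC.
rewrite (exchange_graft_root tsu tsP wsu wsP
  (fun t w => X w *: (Hw (rem t (enum_mset w)) *m g t z1))) -sumrB.
(* Only the empty forest leaves a term at [z2]; its value at [z1] is the summand of the expansion
   for w = 1, as [multfact] is then 1. *)
have term w : X w *: (Hw (enum_mset w) *m h) -
      \sum_(t <- undup (enum_mset w)) X w *: (Hw (rem t (enum_mset w)) *m g t z1) =
    (if w == mset0 then g tau0 z2 else 0) -
    (X w / (symfact w)%:R) *: elem_lc sigma (graft_forest R w tau0) z1.
  rewrite (elem_lc_graft_forest smooth_sigma) -scaler_sumr -scalerBr -multfact_mset.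
  case: eqP => [->|/eqP w0].
    rewrite enum_mset0 big_nil subr0 (H_nil smooth_sigma) X0 /multfact big_nil divr1 !scale1r.
    by [].
  rewrite (H_rec smooth_sigma).
    by rewrite sub0r addrAC subrr add0r scalerN scalerA.
  by rewrite lt0n size_mset_eq0.
under [RHS]eq_bigr do rewrite term.
rewrite sumrB; congr (_ - _).
by rewrite (bigD1_seq mset0)//= ?eqxx ?big1 ?addr0// ?wsP ?/fsize ?enum_mset0 ?big_nil// => w /negPf ->.
Qed.
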